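(* Let $U_6$ be the $\mathbb{Q}$-span of the series $f_{a,b,c}=E_2^aE_4^bE_6^c$ with $a,b,c\in\mathbb{Z}$, $2a+4b+6c=6$, $0\le a\le 4$ and $c\ge0$, and let $U_6^0$ be the subspace of elements of $U_6$ with zero constant term. Then every element of $U_6^0$ is magnetic: for every $v\in U_6^0$ there is an integer $N>0$ with $N\cdot\delta^{-1}v\in q\mathbb{Z}[[q]]$.
   Context: Let $q=e^{2\pi i\tau}$, $\delta=q\frac{d}{dq}$, and $E_2=1-24\sum_{n\ge1}\frac{nq^n}{1-q^n}$, $E_4=1+240\sum_{n\ge1}\frac{n^3q^n}{1-q^n}$, $E_6=1-504\sum_{n\ge1}\frac{n^5q^n}{1-q^n}$, regarded as elements of $\mathbb{Z}[[q]]$ (with $E_4,E_6$ invertible there, so $f_{a,b,c}\in\mathbb{Z}[[q]]$ for negative $b$). For $v=\sum_{n\ge1}c_nq^n$ with rational coefficients, $\delta^{-1}v=\sum_{n\ge1}\frac{c_n}{n}q^n$. *)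

(* Defs.v *)
From HB Require Import structures.
From mathcomp Require Import all_boot all_order all_algebra.
(* boolp: classical equality and choice structures on power series. *)
From mathcomp Require Import boolp.

Set Implicit Arguments.
Unset Strict Implicit.
Unset Printing Implicit Defensive.

Import Order.TTheory GRing.Theory Num.Theory.
Local Open Scope ring_scope.

(* The formal power series f = \sum_n (f n) q^n in R[[q]]. *)
Record fps (R : Type) := Fps { fps_coef : nat -> R }.
Coercion fps_coef : fps >-> Funclass.

Lemma fpsP (R : Type) (f g : fps R) : (forall n, f n = g n) <-> f = g.
Proof.
by split=> [|-> //]; case: f g => [f] [g] /= fg; congr Fps; exact: funext.
Qed.

HB.instance Definition _ (R : Type) := gen_eqMixin (fps R).
HB.instance Definition _ (R : Type) := gen_choiceMixin (fps R).

Section Zmodule.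
Context (R : zmodType).
Implicit Types f g h : fps R.

Definition fps_zero : fps R := Fps (fun=> 0).
Definition fps_opp f : fps R := Fps (fun n => - f n).
Definition fps_add f g : fps R := Fps (fun n => f n + g n).

Fact fps_addA : associative fps_add.
Proof. by move=> f g h; apply/fpsP => n /=; rewrite addrA. Qed.
Fact fps_addC : commutative fps_add.
Proof. by move=> f g; apply/fpsP => n /=; rewrite addrC. Qed.
Fact fps_add0 : left_id fps_zero fps_add.
Proof. by move=> f; apply/fpsP => n /=; rewrite add0r. Qed.
Fact fps_addN : left_inverse fps_zero fps_opp fps_add.
Proof. by move=> f; apply/fpsP => n /=; rewrite addNr. Qed.

HB.instance Definition _ :=
  GRing.isZmodule.Build (fps R) fps_addA fps_addC fps_add0 fps_addN.
End Zmodule.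

Section Ring.
Context (R : comNzRingType).
Implicit Types f g h : fps R.

Definition fps_one : fps R := Fps (fun n => (n == 0)%N%:R).
Definition fps_mul f g : fps R :=
  Fps (fun n => \sum_(i < n.+1) f i * g (n - i)%N).
Definition fps_scale (a : R) f : fps R := Fps (fun n => a * f n).

Let trunc N f : {poly R} := \poly_(i < N) f i.

Let coef_mul_trunc N f g n : (n < N)%N ->
  (fps_mul f g) n = (trunc N f * trunc N g)`_n.
Proof.
move=> nN; rewrite coefM /=; apply: eq_bigr => i _.
by rewrite !coef_poly (leq_ltn_trans _ nN) ?leq_ord //
  (leq_ltn_trans (leq_subr _ _) nN).
Qed.

Let coefM_congr (p p' r r' : {poly R}) n :
    (forall i, (i <= n)%N -> p`_i = p'`_i) ->
    (forall i, (i <= n)%N -> r`_i = r'`_i) ->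
  (p * r)`_n = (p' * r')`_n.
Proof.
move=> pp rr; rewrite !coefM; apply: eq_bigr => i _.
by rewrite pp ?leq_ord // rr // leq_subr.
Qed.

Let trunc_mul f g n i : (i <= n)%N ->
  (trunc n.+1 (fps_mul f g))`_i = (trunc n.+1 f * trunc n.+1 g)`_i.
Proof. by move=> lein; rewrite coef_poly ltnS lein; exact: coef_mul_trunc. Qed.

Fact fps_mulA : associative fps_mul.
Proof.
move=> f g h; apply/fpsP => n; rewrite !(@coef_mul_trunc n.+1) //.
rewrite (@coefM_congr _ (trunc n.+1 f) _ (trunc n.+1 g * trunc n.+1 h)) //;
  last by move=> i; exact: trunc_mul.
rewrite mulrA; apply: coefM_congr => // i lein; by rewrite trunc_mul.
Qed.
Fact fps_mulC : commutative fps_mul.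
Proof.
by move=> f g; apply/fpsP => n; rewrite !(@coef_mul_trunc n.+1) // mulrC.
Qed.
Fact fps_mul1 : left_id fps_one fps_mul.
Proof.
move=> f; apply/fpsP => n /=; rewrite big_ord_recl /= subn0 mul1r.
by rewrite big1 ?addr0 // => i _; rewrite mul0r.
Qed.
Fact fps_mulDl : left_distributive fps_mul +%R.
Proof.
move=> f g h; apply/fpsP => n /=; rewrite -big_split /=.
by apply: eq_bigr => i _; rewrite mulrDl.
Qed.
Fact fps_one_neq0 : fps_one != 0.
Proof. by apply/eqP => /fpsP/(_ 0%N)/eqP; rewrite /= oner_eq0. Qed.

HB.instance Definition _ := GRing.Zmodule_isComNzRing.Build (fps R)
  fps_mulA fps_mulC fps_mul1 fps_mulDl fps_one_neq0.

Fact fps_scaleA a b f : fps_scale a (fps_scale b f) = fps_scale (a * b) f.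
Proof. by apply/fpsP => n /=; rewrite mulrA. Qed.
Fact fps_scale1 : left_id 1 fps_scale.
Proof. by move=> f; apply/fpsP => n /=; rewrite mul1r. Qed.
Fact fps_scaleDr : right_distributive fps_scale +%R.
Proof. by move=> a f g; apply/fpsP => n /=; rewrite mulrDr. Qed.
Fact fps_scaleDl f : {morph fps_scale^~ f : a b / a + b}.
Proof. by move=> a b; apply/fpsP => n /=; rewrite mulrDl. Qed.

HB.instance Definition _ := GRing.Zmodule_isLmodule.Build R (fps R)
  fps_scaleA fps_scale1 fps_scaleDr fps_scaleDl.

Definition fps_q : fps R := Fps (fun n => (n == 1)%N%:R).
End Ring.

Section UnitRing.
Context (R : comUnitRingType).
Implicit Types f g h : fps R.

Definition fps_unit : {pred fps R} := fun f => f 0%N \is a GRing.unit.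

(* The coefficients of index at most n of the inverse of f, obtained by solving
   \sum_(i <= m) f (m - i) * g i = (m == 0) recursively for g m. *)
Fixpoint fps_inv_coefs f n : seq R :=
  if n is m.+1 then
    let s := fps_inv_coefs f m in
    rcons s (- ((f 0%N)^-1 * \sum_(i < m.+1) f (m.+1 - i)%N * s`_i))
  else [:: (f 0%N)^-1].

Definition fps_inv f : fps R :=
  if f \in fps_unit then Fps (fun n => (fps_inv_coefs f n)`_n) else f.

Let size_inv_coefs f n : size (fps_inv_coefs f n) = n.+1.
Proof. by elim: n => //= n IHn; rewrite size_rcons IHn. Qed.

Let nth_inv_coefs f n i : (i <= n)%N ->
  (fps_inv_coefs f n)`_i = (fps_inv_coefs f i)`_i.
Proof.
elim: n => [|n IHn]; first by rewrite leqn0 => /eqP ->.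
rewrite leq_eqVlt => /predU1P[-> //|]; rewrite ltnS => lein.
by rewrite [in LHS]/= nth_rcons size_inv_coefs ltnS lein IHn.
Qed.

Fact fps_mulV : {in fps_unit, left_inverse 1 fps_inv *%R}.
Proof.
move=> f Uf; rewrite mulrC; apply/fpsP => n; rewrite /fps_inv Uf.
have U0 : f 0%N \is a GRing.unit := Uf.
rewrite [LHS](_ : _ = \sum_(i < n.+1) f (n - i)%N * (fps_inv_coefs f i)`_i).
  case: n => [|n]; first by rewrite big_ord1 subnn mulrV.
  rewrite big_ord_recr /= subnn nth_rcons size_inv_coefs.
  rewrite ltnn eqxx mulrN mulrA mulrV // mul1r [RHS]/=; apply/eqP.
  rewrite subr_eq0; apply/eqP/eq_bigr => i _.
  by rewrite [in RHS]nth_inv_coefs ?leq_ord.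
rewrite /= (reindex_inj rev_ord_inj) /=; apply: eq_bigr => i _.
by rewrite subSS subKn ?leq_ord.
Qed.
Fact fps_unitPl f g : g * f = 1 -> f \in fps_unit.
Proof.
move=> /fpsP/(_ 0%N); rewrite /= big_ord1 /= => gf1.
by apply/unitrPr; exists (g 0%N); rewrite mulrC.
Qed.
Fact fps_inv_out : {in [predC fps_unit], fps_inv =1 id}.
Proof. by move=> f /negbTE; rewrite /fps_inv => ->. Qed.

HB.instance Definition _ := GRing.ComNzRing_hasMulInverse.Build (fps R)
  fps_mulV fps_unitPl fps_inv_out.
End UnitRing.

Definition fps_map (R S : Type) (phi : R -> S) (f : fps R) : fps S :=
  Fps (fun n => phi (f n)).

(* \sum_(n >= 1) n^k q^n / (1 - q^n) in Z[[q]]: the n-th term is divisible by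
   q^n, so that only the terms with n <= m contribute to the coefficient of
   q^m. *)
Definition lambert (k : nat) : fps int :=
  Fps (fun m => \sum_(1 <= n < m.+1)
    ((n ^ k)%:R *: (fps_q int ^+ n / (1 - fps_q int ^+ n))) m).

Definition E2 : fps int := 1 - 24 *: lambert 1.
Definition E4 : fps int := 1 + 240 *: lambert 3.
Definition E6 : fps int := 1 - 504 *: lambert 5.

(* E2, E4 and E6 are units of Z[[q]], so ^ is a genuine integer power. *)
Definition fabc (a b c : int) : fps int := E2 ^ a * E4 ^ b * E6 ^ c.

Definition lin_span (K : pzRingType) (V : lmodType K) (S : V -> Prop) (v : V) :
    Prop :=
  exists (m : nat) (x : 'I_m -> K) (u : 'I_m -> V),
    (forall i, S (u i)) /\ v = \sum_(i < m) x i *: u i.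

Definition U6 : fps rat -> Prop :=
  lin_span (fun u : fps rat => exists a b c : int,
    [/\ 2 * a + 4 * b + 6 * c = 6, 0 <= a <= 4, 0 <= c
      & u = fps_map intr (fabc a b c)]).

Definition U6_0 (v : fps rat) : Prop := U6 v /\ v 0%N = 0.

(* Intended for series without constant term; the coefficient of index 0 of
   the result is always 0, because v 0 / 0 = 0. *)
Definition delta_inv (v : fps rat) : fps rat := Fps (fun n => v n / n%:R).

Definition magnetic (v : fps rat) : Prop :=
  exists2 N : int, 0 < N &
    exists w : fps int,
      w 0%N = 0 /\ N%:~R *: delta_inv v = fps_map intr w.

(* Main.v *)
(* Ramanujan's differential equations for E2, E4, E6 express delta of a weight 4
   monomial as a combination of weight 6 monomials. Modulo such exact series
   every monomial of U6 reduces, by induction on a + c, to E6 or to E6^3 / E4^3.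
   With t = 1/j one has E6 - E6^3 / E4^3 = 1728 E4 delta(t), and E4 = A(t)^2 for
   the hypergeometric series A = sum u_m t^m, u_m = (6m)! / ((3m)! m!^3); the
   primitive of A^2 is integral because i + j + 1 divides u_i u_j. The identity
   E4 = A(t)^2 holds because A(t) and E4^(1/2) have logarithmic derivatives that
   satisfy the same Riccati equation. *)
From HB Require Import structures.
Require Import Defs.
From mathcomp Require Import all_boot all_order all_algebra.
From mathcomp Require Import ring zify.

Set Implicit Arguments.
Unset Strict Implicit.
Unset Printing Implicit Defensive.

Import Order.TTheory GRing.Theory Num.Theory.
Local Open Scope ring_scope.

(** The bound a <= 4 is what closes the reduction. In weight 4, [delta] of E2^a E4^b E6^c contains
    E2^(a+1) with a coefficient proportional to a + 4b + 6c = 4 - a, so E2^5 never occurs. Sort the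
    weight 6 monomials by the level k with 2k + 1 = a + c. On each level k >= 2 there are five
    monomials and five relations modulo level k - 1, and the system is triangular with nonzero
    diagonal. On levels 0 and 1 the condition c >= 0 leaves one relation too few, so one class
    survives on each: E6 and E6^3 / E4^3. These relations cannot link the two classes; the
    hypergeometric primitive does. What remains is a multiple of E6, and the constant term detects
    it.

    The square root of E4 is never formed: only its logarithmic derivative occurs, which is a
    polynomial in E2 E4 / E6. Everything up to the final reduction therefore stays in Z[[q]]. *)

Section PowerSeries.
Context (R : comNzRingType).
Implicit Types (f g t : fps R) (n : nat).

Lemma coef_fpsM f g n : (f * g) n = \sum_(i < n.+1) f i * g (n - i)%N.
Proof. by []. Qed.

Lemma coef_fpsD f g n : (f + g) n = f n + g n.
Proof. by []. Qed.

Lemma coef_fpsN f n : (- f) n = - f n.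
Proof. by []. Qed.

Lemma coef_fps1 n : (1 : fps R) n = (n == 0)%N%:R.
Proof. by []. Qed.

Lemma coef_fpsZ c f n : (c *: f) n = c * f n.
Proof. by []. Qed.

Lemma coef_fps_sum (I : Type) (r : seq I) (P : pred I) (F : I -> fps R) n :
  (\sum_(i <- r | P i) F i) n = \sum_(i <- r | P i) F i n.
Proof. by elim/big_rec2: _ => // i x y _ <-. Qed.

Lemma coef_fpsMn f m n : (f *+ m) n = f n *+ m.
Proof. by elim: m => // m IHm; rewrite !mulrS coef_fpsD IHm. Qed.

Lemma coef_fpsM0 f g : (f * g) 0%N = f 0%N * g 0%N.
Proof. by rewrite coef_fpsM big_ord1. Qed.

Lemma coef_fpsX0 f m : (f ^+ m) 0%N = f 0%N ^+ m.
Proof. by elim: m => // m IHm; rewrite !exprS coef_fpsM0 IHm. Qed.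

Lemma fps_scalerAl c f g : c *: (f * g) = (c *: f) * g.
Proof.
by apply/fpsP => n; rewrite !coef_fpsZ !coef_fpsM mulr_sumr;
  apply: eq_bigr => i _; rewrite mulrA.
Qed.

Lemma fps_natmul m f : m%:R * f = m%:R *: f.
Proof. by rewrite mulr_natl scaler_nat. Qed.

Lemma coef_fps_qM f n : (fps_q R * f) n = if n is m.+1 then f m else 0.
Proof.
case: n => [|n]; first by rewrite coef_fpsM0 mul0r.
rewrite coef_fpsM 2!big_ord_recl /= mul0r mul1r add0r subSS subn0.
by rewrite big1 ?addr0 // => i _; rewrite mul0r.
Qed.

Lemma eq_coef_fpsM f f' g g' n :
    (forall i, (i <= n)%N -> f i = f' i) ->
    (forall i, (i <= n)%N -> g i = g' i) ->
  (f * g) n = (f' * g') n.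
Proof.
move=> ff gg; rewrite !coef_fpsM; apply: eq_bigr => i _.
by rewrite ff ?leq_ord // gg // leq_subr.
Qed.

(** A factor without constant term makes coefficient n depend only on coefficients below n. The
    inductions for composition and for uniqueness of solutions rest on this. *)
Lemma eq_coef_fpsM_low t f g n : t 0%N = 0 ->
  (forall i, (i < n)%N -> f i = g i) -> (t * f) n = (t * g) n.
Proof.
move=> t0 fg; rewrite !coef_fpsM !big_ord_recl t0 !mul0r; congr (_ + _).
by apply: eq_bigr => i _; rewrite fg //= /bump /=; have := ltn_ord i; lia.
Qed.

Definition delta f : fps R := Fps (fun n => f n *+ n).

Lemma coef_delta f n : delta f n = f n *+ n.
Proof. by []. Qed.

Lemma deltaD f g : delta (f + g) = delta f + delta g.
Proof. by apply/fpsP => n; rewrite /= mulrnDl. Qed.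

Lemma deltaN f : delta (- f) = - delta f.
Proof. by apply/fpsP => n; rewrite /= mulNrn. Qed.

Lemma deltaM f g : delta (f * g) = delta f * g + f * delta g.
Proof.
apply/fpsP => n; rewrite coef_fpsD coef_delta !coef_fpsM -sumrMnl -big_split.
apply: eq_bigr => i _ /=.
by rewrite mulrnAl mulrnAr -mulrnDr subnKC // -ltnS ltn_ord.
Qed.

HB.instance Definition _ := GRing.isZmodMorphism.Build (fps R) (fps R) delta
  (fun f g => etrans (deltaD f (- g)) (congr1 (+%R (delta f)) (deltaN g))).

Lemma delta_sum (I : Type) (r : seq I) (P : pred I) (F : I -> fps R) :
  delta (\sum_(i <- r | P i) F i) = \sum_(i <- r | P i) delta (F i).
Proof. exact: raddf_sum. Qed.

Lemma deltaZ c f : delta (c *: f) = c *: delta f.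
Proof. by apply/fpsP => n; rewrite coef_fpsZ !coef_delta mulrnAr. Qed.

Lemma delta1 : delta 1 = 0.
Proof. by apply/fpsP => -[|n]; rewrite coef_delta ?mulr0n // mul0rn. Qed.

Lemma deltaX f m : delta (f ^+ m.+1) = f ^+ m * delta f *+ m.+1.
Proof.
elim: m => [|m IHm]; first by rewrite !expr1 expr0 mul1r mulr1n.
by rewrite exprS deltaM IHm mulrnAr mulrA -exprS [in RHS]mulrS mulrC.
Qed.

End PowerSeries.

Section UnitPowerSeries.
Context (R : comUnitRingType).
Implicit Types (f u : fps R) (n : nat).

Lemma fps_unitE f : (f \is a GRing.unit) = (f 0%N \is a GRing.unit).
Proof. by []. Qed.

Lemma coef_fpsV0 u : u 0%N = 1 -> u^-1 0%N = 1.
Proof.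
move=> u0; have Uu : u \is a GRing.unit by rewrite fps_unitE u0 unitr1.
have := congr1 (fun f : fps R => f 0%N) (mulrV Uu).
by rewrite coef_fpsM0 u0 mul1r => ->.
Qed.

End UnitPowerSeries.

(** * Ramanujan's differential equations *)

Section LambertProducts.

Let q := fps_q int.

Lemma coef_fps_qXM (f : fps int) m n : (n < m)%N -> (q ^+ m * f) n = 0.
Proof.
elim: m n => // m IHm n; rewrite ltnS => lenm.
rewrite exprS -mulrA coef_fps_qM; case: n lenm => // n ltnm; exact: IHm.
Qed.

Lemma unit_1subqX m : (0 < m)%N -> 1 - q ^+ m \is a GRing.unit.
Proof.
move=> m_gt0; rewrite fps_unitE coef_fpsD coef_fpsN coef_fpsX0 /=.
by rewrite expr0n eqn0Ngt m_gt0 subr0.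
Qed.

Definition lam m : fps int := q ^+ m / (1 - q ^+ m).

Lemma coef_lamM f m n : (n < m)%N -> (lam m * f) n = 0.
Proof. by rewrite -mulrA; exact: coef_fps_qXM. Qed.

Lemma coef_lam m n : (n < m)%N -> lam m n = 0.
Proof. by move=> ltnm; rewrite -[lam m]mulr1 coef_lamM. Qed.

Lemma lamE m : (0 < m)%N -> q ^+ m * (1 + lam m) = lam m.
Proof.
move=> m_gt0; have Um := unit_1subqX m_gt0; apply: (mulIr Um).
rewrite -mulrA mulrDl mul1r /lam divrK //; ring.
Qed.

(** The left side is the sum of q^(am + bn) over m, n >= 1; the three terms on the right come from m
    = n, m > n and m < n. *)
Lemma lam_mul a b : (0 < a)%N -> (0 < b)%N ->
  lam a * lam b = lam (a + b) * (1 + lam a + lam b).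
Proof.
move=> a_gt0 b_gt0; have ab_gt0 : (0 < a + b)%N by rewrite addn_gt0 a_gt0.
apply: (mulIr (unit_1subqX ab_gt0)).
rewrite [RHS]mulrAC [lam (a + b)]/lam divrK ?unit_1subqX //.
have := lamE a_gt0; have := lamE b_gt0; rewrite exprD.
move: (lam a) (lam b) (q ^+ a) (q ^+ b) => x y u v yE xE.
have uy : x * y = u * v * ((1 + x) * (1 + y)) by rewrite -[in LHS]xE -[in LHS]yE; ring.
by rewrite mulrBr mulr1 {1}uy; ring.
Qed.

Lemma delta_q : delta q = q.
Proof. by apply/fpsP => -[|[|n]]; rewrite coef_delta ?mulr0n // mul0rn. Qed.

Lemma delta_qX m : delta (q ^+ m) = q ^+ m *+ m.
Proof.
case: m => [|m]; first by rewrite expr0 delta1 mulr0n.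
by rewrite deltaX delta_q -exprSr.
Qed.

Lemma delta_lam m : (0 < m)%N -> delta (lam m) = (lam m + lam m ^+ 2) *+ m.
Proof.
move=> m_gt0; have Um := unit_1subqX m_gt0; apply: (mulIr Um).
have := congr1 (@delta _) (divrK Um (q ^+ m)).
rewrite -/(lam m) deltaM raddfB /= delta1 sub0r delta_qX => dE.
have -> : delta (lam m) * (1 - q ^+ m) = (q ^+ m + lam m * q ^+ m) *+ m.
  by rewrite mulrnDl -dE -mulrnAr; ring.
rewrite mulrnAl; congr (_ *+ m); have lamK := divrK Um (q ^+ m).
have -> : lam m + lam m ^+ 2 = (1 + lam m) * lam m by ring.
rewrite -/(lam m) in lamK; move: (lam m) lamK => x lamK.
by rewrite -mulrA lamK; ring.
Qed.

Lemma big_nat_trunc (V : zmodType) (phi : nat -> V) m n N : (m <= n <= N)%N ->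
    (forall x, (n <= x)%N -> phi x = 0) ->
  \sum_(m <= a < N) phi a = \sum_(m <= a < n) phi a.
Proof.
move=> /andP[lemn lenN] phi0; rewrite (@big_cat_nat _ _ _ n) //=.
by rewrite [X in _ + X]big_nat [X in _ + X]big1 ?addr0 // => x /andP[/phi0].
Qed.

Lemma coef_lambert k n N : (n <= N)%N ->
  lambert k n = \sum_(1 <= a < N.+1) a%:R ^+ k * lam a n.
Proof.
move=> lenN; rewrite (@big_nat_trunc _ _ 1 n.+1) ?ltnS //.
  by apply: eq_big_nat => a _; rewrite natrX.
by move=> a ltna; rewrite coef_lam ?mulr0.
Qed.

Lemma coef_lambertM i j n :
  (lambert i * lambert j) n = \sum_(1 <= a < n.+1) \sum_(1 <= b < n.+1)
    a%:R ^+ i * b%:R ^+ j * (lam a * lam b) n.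
Proof.
pose S k : fps int := \sum_(1 <= a < n.+1) a%:R ^+ k *: lam a.
have SE k l : (l <= n)%N -> lambert k l = S k l.
  by move=> leln; rewrite (coef_lambert k leln) coef_fps_sum.
rewrite (eq_coef_fpsM (SE i) (SE j)) mulr_suml coef_fps_sum.
apply: eq_bigr => a _; rewrite mulr_sumr coef_fps_sum.
apply: eq_bigr => b _; rewrite -fps_scalerAl mulrC -fps_scalerAl mulrC.
by rewrite scalerA.
Qed.

Lemma big_nat_shift (V : zmodType) (phi : nat -> V) a n :
    (forall x, (n < x)%N -> phi x = 0) ->
  \sum_(1 <= b < n.+1) phi (a + b)%N =
  \sum_(1 <= x < n.+1) phi x *+ (a < x)%N.
Proof.
move=> phi0; have [ltna|lean] := ltnP n a.
  rewrite !big_nat !big1 // => x /andP[_ xn]; last by rewrite phi0 //; lia.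
  by have -> : (a < x)%N = false by lia.
rewrite (@big_nat_trunc _ _ 1 (n.+1 - a)%N); [|lia|by move=> x ltx; apply: phi0; lia].
rewrite [RHS](@big_cat_nat _ _ _ a.+1) //= [in RHS]big_nat [X in _ = X + _]big1 ?add0r.
  rewrite -[a.+1]add1n big_addn; apply: eq_big_nat => x /andP[x_gt0 _].
  by rewrite addnC -[X in (X < _)%N]add0n ltn_add2r x_gt0.
by move=> x /andP[_ xa]; have -> : (a < x)%N = false by lia.
Qed.

(* Liouville's device: the rule lam_mul replaces the pair (a, b) by the pairs
   (a + b, a) and (a + b, b), so that a weight k is traded for h. *)
Lemma coef_lam_pairs (k h : nat -> nat -> int) n :
    (forall a b, k a b = k b a) -> (forall a b, h a b = h b a) ->
    (forall a b, h (a + b)%N a = k a b) ->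
  \sum_(1 <= a < n.+1) \sum_(1 <= b < n.+1)
     (k a b - h a b) * (lam a * lam b) n =
  \sum_(1 <= d < n.+1) (\sum_(1 <= a < d) k a (d - a)%N) * lam d n
  - \sum_(1 <= a < n.+1) h a a * (lam a ^+ 2) n.
Proof.
move=> kC hC hk; set s := index_iota 1 n.+1.
pose F a b := (lam a * lam b) n.
have FC a b : F a b = F b a by rewrite /F mulrC.
have F0 a b : (n < a)%N -> F a b = 0 by exact: coef_lamM.
have FS a b : (0 < a)%N -> (0 < b)%N ->
    F a b = lam (a + b) n + F (a + b)%N a + F (a + b)%N b.
  by move=> a_gt0 b_gt0; rewrite /F lam_mul // !mulrDr mulr1 !coef_fpsD.
have FE a b : (lam a * lam b) n = F a b by [].
have FE2 a : (lam a ^+ 2) n = F a a by rewrite expr2.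
clearbody F.
(* The pairs (a + b, a) produced from [k] are the off-diagonal pairs of [h], so the sums of [H]
   cancel in the difference and only the diagonal survives. *)
pose H a x := h x a * F x a *+ (a < x)%N.
have kF : \sum_(a <- s) \sum_(b <- s) k a b * F (a + b)%N a =
          \sum_(a <- s) \sum_(x <- s) H a x.
  apply: eq_bigr => a _; rewrite -(@big_nat_shift _ (fun x => h x a * F x a)).
    by apply: eq_bigr => b _; rewrite hk.
  by move=> x ltnx; rewrite F0 ?mulr0.
have kG : \sum_(a <- s) \sum_(b <- s) k a b * lam (a + b) n =
    \sum_(d <- s) (\sum_(1 <= a < d) k a (d - a)%N) * lam d n.
  transitivity (\sum_(a <- s) \sum_(x <- s) k a (x - a)%N * lam x n *+ (a < x)%N).
    apply: eq_bigr => a _; rewrite -(@big_nat_shift _ (fun x => k a (x - a)%N * lam x n)).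
      by apply: eq_bigr => b _; rewrite addKn.
    by move=> x ltnx; rewrite coef_lam ?mulr0.
  rewrite exchange_big; apply: eq_big_nat => d /andP[d_gt0 ledn].
  rewrite mulr_suml (@big_nat_trunc _ _ 1 d); [|lia|].
    by apply: eq_big_nat => x /andP[_ ->].
  by move=> x ledx; have -> : (x < d)%N = false by lia.
have kE : \sum_(a <- s) \sum_(b <- s) k a b * F a b =
   \sum_(d <- s) (\sum_(1 <= a < d) k a (d - a)%N) * lam d n
   + (\sum_(a <- s) \sum_(x <- s) H a x) *+ 2.
  have kF' : \sum_(a <- s) \sum_(b <- s) k a b * F (a + b)%N b =
             \sum_(a <- s) \sum_(x <- s) H a x.
    rewrite exchange_big -kF; apply: eq_bigr => a _; apply: eq_bigr => b _.
    by rewrite kC addnC.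
  rewrite -kG mulr2n -{1}kF -kF' -!big_split; apply: eq_big_nat => a /andP[a_gt0 _].
  rewrite -!big_split; apply: eq_big_nat => b /andP[b_gt0 _] /=.
  by rewrite FS //; ring.
have hE : \sum_(a <- s) \sum_(b <- s) h a b * F a b =
   (\sum_(a <- s) \sum_(x <- s) H a x) *+ 2
   + \sum_(a <- s) h a a * (lam a ^+ 2) n.
  have -> : \sum_(a <- s) h a a * (lam a ^+ 2) n =
      \sum_(a <- s) \sum_(x <- s) h a x * F a x *+ (x == a).
    apply: eq_big_nat => a /andP[a_gt0 lean]; rewrite FE2 (bigD1_seq a) ?iota_uniq //=.
      by rewrite eqxx big1 ?addr0 // => x /negPf->.
    by rewrite mem_index_iota a_gt0.
  rewrite mulr2n [X in _ + X + _]exchange_big -!big_split; apply: eq_bigr => a _.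
  rewrite -!big_split; apply: eq_bigr => x _ /=.
  by rewrite /H [h x a]hC [F x a]FC; case: (ltngtP a x) => // _;
    rewrite ?mulr0n ?mulr1n ?addr0 ?add0r.
transitivity (\sum_(a <- s) \sum_(b <- s) k a b * F a b
            - \sum_(a <- s) \sum_(b <- s) h a b * F a b).
  rewrite -sumrB; apply: eq_bigr => a _; rewrite -sumrB.
  by apply: eq_bigr => b _; rewrite FE mulrBl.
by rewrite kE hE; ring.
Qed.

(** Here h(a, b) = w(b, a - b), which gives h(a + b, a) = w(a, b) after a swap; the second
    hypothesis is the symmetry of h. Both x^2 + xy + y^2 and the square of xy(x + y) have these
    symmetries. *)
Lemma coef_lam_weights (w : int -> int -> int) n :
    (forall x y, w x y = w y x) -> (forall x y, w y (x - y) = w x (y - x)) ->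
  \sum_(1 <= a < n.+1) \sum_(1 <= b < n.+1)
     (w a%:R b%:R - w b%:R (a%:R - b%:R)) * (lam a * lam b) n =
  \sum_(1 <= d < n.+1) (\sum_(1 <= a < d) w a%:R (d%:R - a%:R)) * lam d n
  - \sum_(1 <= a < n.+1) w a%:R 0 * (lam a ^+ 2) n.
Proof.
move=> wC wB; rewrite (@coef_lam_pairs (fun a b => w a%:R b%:R)
  (fun a b => w b%:R (a%:R - b%:R))) => [|a b|a b|a b]; first 1 last.
- exact: wC.
- exact: wB.
- by rewrite natrD addrC addKr.
congr (_ - _); last by apply: eq_bigr => a _; rewrite subrr.
apply: eq_big_nat => d _; congr (_ * _); apply: eq_big_nat => a /andP[_ ltad].
by rewrite natrB // ltnW.
Qed.

(** Converts the diagonal squares left by [coef_lam_weights] into a derivative: the factor n is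
    [delta] on coefficients. *)
Lemma coef_lam_sqr a n : (0 < a)%N ->
  a%:R * (lam a ^+ 2) n = n%:R * lam a n - a%:R * lam a n.
Proof.
move=> a_gt0; have := congr1 (fun f : fps int => f n) (delta_lam a_gt0).
by rewrite coef_delta coef_fpsMn coef_fpsD mulrnDl !mulr_natl => ->;
  rewrite addrAC subrr add0r.
Qed.

(* In coef_lam_weights the powers of x^2 + x y + y^2 yield S1 S1, S1 S3 and a
   combination of S1 S5 and S3 S3, where Sk is lambert k; weight4 isolates S3 S3
   and serves to eliminate lambert 7. *)
Definition weight1 (x y : int) := x ^+ 2 + x * y + y ^+ 2.

(** The parameter z stays free, since the induction on n must not change the summand; z = n + 1 is
    substituted only afterwards. [D] names n as an integer, so that [ring] sees a plain variable. *)
Lemma sum_weight1 n (D z : int) : D = n%:R ->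
  6 * \sum_(1 <= a < n.+1) weight1 a%:R (z - a%:R) =
    2 * D ^+ 3 - 3 * D ^+ 2 * z + 3 * D ^+ 2 + 6 * D * z ^+ 2 - 3 * D * z + D.
Proof.
elim: n D => [|n IHn] D DE; first by rewrite big_geq // DE; ring.
rewrite big_nat_recr //= mulrDr (IHn (D - 1)); last by rewrite DE -natr1 addrK.
by rewrite -DE /weight1; ring.
Qed.

Definition weight2 (x y : int) := (x ^+ 2 + x * y + y ^+ 2) ^+ 2.

Lemma sum_weight2 n (D z : int) : D = n%:R ->
  30 * \sum_(1 <= a < n.+1) weight2 a%:R (z - a%:R) =
    6 * D ^+ 5 - 15 * D ^+ 4 * z + 15 * D ^+ 4 + 30 * D ^+ 3 * z ^+ 2 - 30 *
    D ^+ 3 * z + 10 * D ^+ 3 - 30 * D ^+ 2 * z ^+ 3 + 45 * D ^+ 2 * z ^+ 2 -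
    15 * D ^+ 2 * z + 30 * D * z ^+ 4 - 30 * D * z ^+ 3 + 15 * D * z ^+ 2 - D.
Proof.
elim: n D => [|n IHn] D DE; first by rewrite big_geq // DE; ring.
rewrite big_nat_recr //= mulrDr (IHn (D - 1)); last by rewrite DE -natr1 addrK.
by rewrite -DE /weight2; ring.
Qed.

Definition weight3 (x y : int) := (x ^+ 2 + x * y + y ^+ 2) ^+ 3.

Lemma sum_weight3 n (D z : int) : D = n%:R ->
  420 * \sum_(1 <= a < n.+1) weight3 a%:R (z - a%:R) =
    60 * D ^+ 7 - 210 * D ^+ 6 * z + 210 * D ^+ 6 + 504 * D ^+ 5 * z ^+ 2 -
    630 * D ^+ 5 * z + 210 * D ^+ 5 - 735 * D ^+ 4 * z ^+ 3 + 1260 * D ^+ 4 *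
    z ^+ 2 - 525 * D ^+ 4 * z + 840 * D ^+ 3 * z ^+ 4 - 1470 * D ^+ 3 * z ^+
    3 + 840 * D ^+ 3 * z ^+ 2 - 70 * D ^+ 3 - 630 * D ^+ 2 * z ^+ 5 + 1260 *
    D ^+ 2 * z ^+ 4 - 735 * D ^+ 2 * z ^+ 3 + 105 * D ^+ 2 * z + 420 * D * z
    ^+ 6 - 630 * D * z ^+ 5 + 420 * D * z ^+ 4 - 84 * D * z ^+ 2 + 10 * D.
Proof.
elim: n D => [|n IHn] D DE; first by rewrite big_geq // DE; ring.
rewrite big_nat_recr //= mulrDr (IHn (D - 1)); last by rewrite DE -natr1 addrK.
by rewrite -DE /weight3; ring.
Qed.

Definition weight4 (x y : int) := x ^+ 2 * y ^+ 2 * (x + y) ^+ 2.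

Lemma sum_weight4 n (D z : int) : D = n%:R ->
  30 * \sum_(1 <= a < n.+1) weight4 a%:R (z - a%:R) =
    6 * D ^+ 5 * z ^+ 2 - 15 * D ^+ 4 * z ^+ 3 + 15 * D ^+ 4 * z ^+ 2 + 10 *
    D ^+ 3 * z ^+ 4 - 30 * D ^+ 3 * z ^+ 3 + 10 * D ^+ 3 * z ^+ 2 + 15 * D ^+
    2 * z ^+ 4 - 15 * D ^+ 2 * z ^+ 3 + 5 * D * z ^+ 4 - D * z ^+ 2.
Proof.
elim: n D => [|n IHn] D DE; first by rewrite big_geq // DE; ring.
rewrite big_nat_recr //= mulrDr (IHn (D - 1)); last by rewrite DE -natr1 addrK.
by rewrite -DE /weight4; ring.
Qed.

Lemma sum_weight1_diag d : (0 < d)%N ->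
  6 * \sum_(1 <= a < d) weight1 a%:R (d%:R - a%:R) =
  5 * d%:R ^+ 3 - 6 * d%:R ^+ 2 + d%:R.
Proof.
by case: d => // d _; rewrite (sum_weight1 _ erefl) -natr1; ring.
Qed.

Lemma sum_weight2_diag d : (0 < d)%N ->
  30 * \sum_(1 <= a < d) weight2 a%:R (d%:R - a%:R) =
  21 * d%:R ^+ 5 - 30 * d%:R ^+ 4 + 10 * d%:R ^+ 3 - d%:R.
Proof.
by case: d => // d _; rewrite (sum_weight2 _ erefl) -natr1; ring.
Qed.

Lemma sum_weight3_diag d : (0 < d)%N ->
  420 * \sum_(1 <= a < d) weight3 a%:R (d%:R - a%:R) =
  249 * d%:R ^+ 7 - 420 * d%:R ^+ 6 + 210 * d%:R ^+ 5 - 49 * d%:R ^+ 3 + 10 * d%:R.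
Proof.
by case: d => // d _; rewrite (sum_weight3 _ erefl) -natr1; ring.
Qed.

Lemma sum_weight4_diag d : (0 < d)%N ->
  30 * \sum_(1 <= a < d) weight4 a%:R (d%:R - a%:R) =
  d%:R ^+ 7 - d%:R ^+ 3.
Proof.
by case: d => // d _; rewrite (sum_weight4 _ erefl) -natr1; ring.
Qed.

Lemma coef_lam_weights_eval (w : int -> int -> int) c (Q : nat -> int) n :
    (forall x y, w x y = w y x) -> (forall x y, w y (x - y) = w x (y - x)) ->
    (forall d, (0 < d)%N -> c * (\sum_(1 <= a < d) w a%:R (d%:R - a%:R)) = Q d) ->
  \sum_(1 <= a < n.+1) \sum_(1 <= b < n.+1)
     c * (w a%:R b%:R - w b%:R (a%:R - b%:R)) * (lam a * lam b) n =
  \sum_(1 <= d < n.+1) (Q d * lam d n - c * w d%:R 0 * (lam d ^+ 2) n).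
Proof.
move=> wC wB cQ; have := congr1 ( *%R c) (coef_lam_weights n wC wB).
rewrite mulrBr !mulr_sumr -sumrB => eqw.
transitivity (\sum_(1 <= a < n.+1) c * \sum_(1 <= b < n.+1)
     (w a%:R b%:R - w b%:R (a%:R - b%:R)) * (lam a * lam b) n).
  apply: eq_bigr => a _; rewrite mulr_sumr; apply: eq_bigr => b _.
  by rewrite mulrA.
by rewrite eqw; apply: eq_big_nat => d /andP[d_gt0 _]; rewrite !mulrA cQ.
Qed.

Lemma coef_lambert1_sqr n :
  12 * (lambert 1 * lambert 1) n =
  5 * lambert 3 n + lambert 1 n - 6 * delta (lambert 1) n.
Proof.
have wC x y : weight1 x y = weight1 y x by rewrite /weight1; ring.
have wB x y : weight1 y (x - y) = weight1 x (y - x) by rewrite /weight1; ring.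
have eqw := coef_lam_weights_eval n wC wB sum_weight1_diag.
rewrite !coef_lambertM.
transitivity (\sum_(1 <= a < n.+1) \sum_(1 <= b < n.+1) 6 *
    (weight1 a%:R b%:R - weight1 b%:R (a%:R - b%:R)) * (lam a * lam b) n).
  rewrite !mulr_sumr -?big_split -?big_split ?mulr_sumr; apply: eq_bigr => a _.
  rewrite !mulr_sumr -?big_split -?big_split ?mulr_sumr; apply: eq_bigr => b _.
  by rewrite /weight1; move: (lam a * lam b) => f /=; ring.
rewrite eqw coef_delta -[lambert _ n *+ n]mulr_natl !(coef_lambert _ (leqnn n)).
rewrite !mulr_sumr -?sumrB -?big_split -?sumrB -?sumrB;
  apply: eq_big_nat => d /andP[d_gt0 _].
have dE := coef_lam_sqr n d_gt0; move: (lam d) (lam d ^+ 2) dE => f g dE.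
(* One factor d is set aside for [coef_lam_sqr]. *)
have -> : 6 * weight1 d%:R 0 * g n = 6 * d%:R ^+ 1 * (d%:R * g n).
  by rewrite /weight1; ring.
by rewrite dE /=; ring.
Qed.

Lemma coef_lambert13 n :
  240 * (lambert 1 * lambert 3) n =
  21 * lambert 5 n + 10 * lambert 3 n - lambert 1 n - 30 * delta (lambert 3) n.
Proof.
have wC x y : weight2 x y = weight2 y x by rewrite /weight2; ring.
have wB x y : weight2 y (x - y) = weight2 x (y - x) by rewrite /weight2; ring.
have eqw := coef_lam_weights_eval n wC wB sum_weight2_diag.
transitivity (120 * (lambert 1 * lambert 3) n + 120 * (lambert 3 * lambert 1) n).
  by rewrite [lambert 3 * _]mulrC; move: ((lambert 1 * lambert 3) n) => x; ring.
rewrite !coef_lambertM.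
transitivity (\sum_(1 <= a < n.+1) \sum_(1 <= b < n.+1) 30 *
    (weight2 a%:R b%:R - weight2 b%:R (a%:R - b%:R)) * (lam a * lam b) n).
  rewrite !mulr_sumr -?big_split -?big_split ?mulr_sumr; apply: eq_bigr => a _.
  rewrite !mulr_sumr -?big_split -?big_split ?mulr_sumr; apply: eq_bigr => b _.
  by rewrite /weight2; move: (lam a * lam b) => f /=; ring.
rewrite eqw coef_delta -[lambert _ n *+ n]mulr_natl !(coef_lambert _ (leqnn n)).
rewrite !mulr_sumr -?sumrB -?big_split -?sumrB -?sumrB;
  apply: eq_big_nat => d /andP[d_gt0 _].
have dE := coef_lam_sqr n d_gt0; move: (lam d) (lam d ^+ 2) dE => f g dE.
have -> : 30 * weight2 d%:R 0 * g n = 30 * d%:R ^+ 3 * (d%:R * g n).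
  by rewrite /weight2; ring.
by rewrite dE /=; ring.
Qed.

Lemma coef_lambert15 n :
  420 * (12 * (lambert 1 * lambert 5) n + 14 * (lambert 3 * lambert 3) n) =
  249 * lambert 7 n + 210 * lambert 5 n - 49 * lambert 3 n + 10 * lambert 1 n
  - 420 * delta (lambert 5) n.
Proof.
have wC x y : weight3 x y = weight3 y x by rewrite /weight3; ring.
have wB x y : weight3 y (x - y) = weight3 x (y - x) by rewrite /weight3; ring.
have eqw := coef_lam_weights_eval n wC wB sum_weight3_diag.
transitivity (420 * (6 * (lambert 1 * lambert 5) n
    + 6 * (lambert 5 * lambert 1) n + 14 * (lambert 3 * lambert 3) n)).
  by rewrite [lambert 5 * _]mulrC;
    move: ((lambert 1 * lambert 5) n) ((lambert 3 * lambert 3) n) => x y; ring.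
rewrite !coef_lambertM.
transitivity (\sum_(1 <= a < n.+1) \sum_(1 <= b < n.+1) 420 *
    (weight3 a%:R b%:R - weight3 b%:R (a%:R - b%:R)) * (lam a * lam b) n).
  rewrite !mulr_sumr -?big_split -?big_split ?mulr_sumr; apply: eq_bigr => a _.
  rewrite !mulr_sumr -?big_split -?big_split ?mulr_sumr; apply: eq_bigr => b _.
  by rewrite /weight3; move: (lam a * lam b) => f /=; ring.
rewrite eqw coef_delta -[lambert _ n *+ n]mulr_natl !(coef_lambert _ (leqnn n)).
rewrite !mulr_sumr -?sumrB -?big_split -?sumrB -?big_split -?sumrB;
  apply: eq_big_nat => d /andP[d_gt0 _].
have dE := coef_lam_sqr n d_gt0; move: (lam d) (lam d ^+ 2) dE => f g dE.
have -> : 420 * weight3 d%:R 0 * g n = 420 * d%:R ^+ 5 * (d%:R * g n).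
  by rewrite /weight3; ring.
by rewrite dE /=; ring.
Qed.

(** [weight4] vanishes when an argument is 0, so no [delta] term appears. This is the identity E4^2
    = E8. *)
Lemma coef_lambert3_sqr n :
  120 * (lambert 3 * lambert 3) n = lambert 7 n - lambert 3 n.
Proof.
have wC x y : weight4 x y = weight4 y x by rewrite /weight4; ring.
have wB x y : weight4 y (x - y) = weight4 x (y - x) by rewrite /weight4; ring.
have eqw := coef_lam_weights_eval n wC wB sum_weight4_diag.
rewrite !coef_lambertM.
transitivity (\sum_(1 <= a < n.+1) \sum_(1 <= b < n.+1) 30 *
    (weight4 a%:R b%:R - weight4 b%:R (a%:R - b%:R)) * (lam a * lam b) n).
  rewrite !mulr_sumr -?big_split -?big_split ?mulr_sumr; apply: eq_bigr => a _.
  rewrite !mulr_sumr -?big_split -?big_split ?mulr_sumr; apply: eq_bigr => b _.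
  by rewrite /weight4; move: (lam a * lam b) => f /=; ring.
rewrite eqw !(coef_lambert _ (leqnn n)).
rewrite  -?sumrB; apply: eq_big_nat => d /andP[d_gt0 _].
have dE := coef_lam_sqr n d_gt0; move: (lam d) (lam d ^+ 2) dE => f g dE.
by rewrite /weight4 /=; ring.
Qed.

End LambertProducts.

Section Ramanujan.

Let S1 := lambert 1.
Let S3 := lambert 3.
Let S5 := lambert 5.

(** Lets [ring] prove a consequence of one known equation, given its cofactor c. *)
Lemma eq_of_multiple (R : pzRingType) (c x y p q : R) :
  p = q -> x - y = c * (p - q) -> x = y.
Proof. by move=> ->; rewrite subrr mulr0; exact: subr0_eq. Qed.

Lemma coef_natM m (f : fps int) n : (m%:R * f) n = m%:R * f n.
Proof. by rewrite fps_natmul. Qed.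

Lemma lambert1_sqr : 12 * (S1 * S1) = 5 * S3 + S1 - 6 * delta S1.
Proof.
apply/fpsP => n; rewrite !coef_fpsD coef_fpsN !coef_natM.
exact: coef_lambert1_sqr.
Qed.

Lemma lambert13 : 240 * (S1 * S3) = 21 * S5 + 10 * S3 - S1 - 30 * delta S3.
Proof.
apply/fpsP => n; rewrite !coef_fpsD !coef_fpsN !coef_natM.
exact: coef_lambert13.
Qed.

Lemma lambert15_33 : 504 * (S1 * S5) - 2400 * (S3 * S3) =
  21 * S5 + 20 * S3 + S1 - 42 * delta S5.
Proof.
apply/fpsP => n; rewrite !coef_fpsD !coef_fpsN !coef_natM.
have := coef_lambert15 n; have := coef_lambert3_sqr n; rewrite -/S1 -/S3 -/S5.
move: ((S1 * S5) n) ((S3 * S3) n) (delta S5 n) (S5 n) (S3 n) (S1 n) => a b c d e f.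
lia.
Qed.

Lemma E2E : E2 = 1 - 24 * S1. Proof. by rewrite fps_natmul. Qed.
Lemma E4E : E4 = 1 + 240 * S3. Proof. by rewrite fps_natmul. Qed.
Lemma E6E : E6 = 1 - 504 * S5. Proof. by rewrite fps_natmul. Qed.

Lemma delta_natM m (f : fps int) : delta (m%:R * f) = m%:R * delta f.
Proof. by rewrite !fps_natmul deltaZ. Qed.

Lemma delta_E2 : 12 * delta E2 = E2 ^+ 2 - E4.
Proof.
have eqS := lambert1_sqr; rewrite E4E E2E raddfB /= delta1 delta_natM.
move: S1 S3 (delta S1) eqS => x y z eqS.
by apply: (eq_of_multiple (c := -48) eqS); ring.
Qed.

Lemma delta_E4 : 3 * delta E4 = E2 * E4 - E6.
Proof.
have eqS := lambert13; rewrite E6E E4E E2E raddfD /= delta1 delta_natM.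
move: S1 S3 S5 (delta S3) eqS => x y z t eqS.
by apply: (eq_of_multiple (c := 24) eqS); ring.
Qed.

Lemma delta_E6 : 2 * delta E6 = E2 * E6 - E4 ^+ 2.
Proof.
have eqS := lambert15_33; rewrite E6E E4E E2E raddfB /= delta1 delta_natM.
move: S1 S3 S5 (delta S5) eqS => x y z t eqS.
by apply: (eq_of_multiple (c := -24) eqS); ring.
Qed.

End Ramanujan.

(** * Derivatives of monomials *)

Section LogDerivative.
Context (R : comUnitRingType).
Implicit Types (u v : fps R).

Definition logd u : fps R := delta u / u.

Lemma logdM u v : u \is a GRing.unit -> v \is a GRing.unit ->
  logd (u * v) = logd u + logd v.
Proof.
move=> Uu Uv; rewrite /logd deltaM invrM // mulrDl mulrA mulrK //; congr (_ + _).
have -> : u * delta v * (v^-1 * u^-1) = delta v * v^-1 * (u * u^-1) by ring.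
by rewrite mulrV // mulr1.
Qed.

Lemma logdV u : u \is a GRing.unit -> logd u^-1 = - logd u.
Proof.
move=> Uu; apply/eqP; rewrite -subr_eq0 opprK -logdM ?unitrV //.
by rewrite mulVr // /logd delta1 mul0r.
Qed.

Lemma logdXz u (m : int) : u \is a GRing.unit -> logd (u ^ m) = m%:~R * logd u.
Proof.
move=> Uu; have logdX k : logd (u ^+ k) = k%:R * logd u.
  elim: k => [|k IHk]; first by rewrite expr0 mul0r /logd delta1 mul0r.
  by rewrite exprS logdM ?unitrX // IHk -natr1 addrC; ring.
case: m => k; first exact: logdX.
by rewrite -[u ^ _]/((u ^+ k.+1)^-1) logdV ?unitrX // logdX NegzE mulrNz mulNr.
Qed.

End LogDerivative.

Lemma E2_coef0 : E2 0%N = 1.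
Proof. by rewrite coef_fpsD coef_fpsN coef_fpsZ /lambert /= big_geq. Qed.
Lemma E4_coef0 : E4 0%N = 1.
Proof. by rewrite coef_fpsD coef_fpsZ /lambert /= big_geq. Qed.
Lemma E6_coef0 : E6 0%N = 1.
Proof. by rewrite coef_fpsD coef_fpsN coef_fpsZ /lambert /= big_geq. Qed.

Lemma unit_coef0 (u : fps int) : u 0%N = 1 -> u \is a GRing.unit.
Proof. by move=> u0; rewrite fps_unitE u0 unitr1. Qed.

Lemma unit_E2 : E2 \is a GRing.unit. Proof. exact/unit_coef0/E2_coef0. Qed.
Lemma unit_E4 : E4 \is a GRing.unit. Proof. exact/unit_coef0/E4_coef0. Qed.
Lemma unit_E6 : E6 \is a GRing.unit. Proof. exact/unit_coef0/E6_coef0. Qed.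

Lemma coef_fpsXz0 (u : fps int) (m : int) : u 0%N = 1 -> (u ^ m) 0%N = 1.
Proof.
move=> u0; case: m => k; first by rewrite -exprnP coef_fpsX0 u0 expr1n.
by rewrite -[u ^ _]/((u ^+ k.+1)^-1) coef_fpsV0 // coef_fpsX0 u0 expr1n.
Qed.

Lemma fabc_coef0 a b c : fabc a b c 0%N = 1.
Proof.
by rewrite !coef_fpsM0 !coef_fpsXz0 ?mulr1 ?E2_coef0 ?E4_coef0 ?E6_coef0.
Qed.

Lemma fabc_mul a b c a' b' c' :
  fabc a b c * fabc a' b' c' = fabc (a + a') (b + b') (c + c').
Proof.
rewrite /fabc !exprzDr ?unit_E2 ?unit_E4 ?unit_E6 //.
move: (E2 ^ a) (E4 ^ b) (E6 ^ c) => x y z; ring.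
Qed.

Lemma fabc100 : fabc 1 0 0 = E2. Proof. by rewrite /fabc expr1z !mulr1. Qed.
Lemma fabc010 : fabc 0 1 0 = E4. Proof. by rewrite /fabc expr1z mulr1 mul1r. Qed.
Lemma fabc001 : fabc 0 0 1 = E6. Proof. by rewrite /fabc expr1z !mul1r. Qed.

Lemma unit_fabc a b c : fabc a b c \is a GRing.unit.
Proof. exact/unit_coef0/fabc_coef0. Qed.

Lemma fabcV a b c : (fabc a b c)^-1 = fabc (- a) (- b) (- c).
Proof.
apply: (mulrI (unit_fabc a b c)); rewrite mulrV ?unit_fabc // fabc_mul !subrr.
by rewrite /fabc !expr0z !mulr1.
Qed.

(** Divided by E2, E4 and E6, Ramanujan's equations express logarithmic derivatives by monomials of
    weight 2; exponents of either sign are then treated alike. *)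
Lemma logd_fabc (a b c : int) :
  12 * logd (fabc a b c) = (a + 4 * b + 6 * c)%:~R * fabc 1 0 0
    - a%:~R * fabc (-1) 1 0 - (4 * b)%:~R * fabc 0 (-1) 1
    - (6 * c)%:~R * fabc 0 2 (-1).
Proof.
have Ez (u : fps int) m : u \is a GRing.unit -> u ^ m \is a GRing.unit by exact: unitrXz.
rewrite /fabc logdM ?unitrM ?Ez ?unit_E2 ?unit_E4 ?unit_E6 //.
rewrite logdM ?Ez ?unit_E2 ?unit_E4 ?unit_E6 //.
rewrite !logdXz ?unit_E2 ?unit_E4 ?unit_E6 //.
have l2 : 12 * logd E2 = fabc 1 0 0 - fabc (-1) 1 0.
  rewrite /logd mulrA delta_E2 mulrBl expr2 mulrK ?unit_E2 // fabc100; congr (_ - _).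
  by rewrite -[in LHS]fabc010 -[in LHS]fabc100 fabcV fabc_mul.
have l4 : 12 * logd E4 = 4 * (fabc 1 0 0 - fabc 0 (-1) 1).
  have -> : 12 * logd E4 = 4 * (3 * delta E4 / E4) by rewrite /logd; ring.
  rewrite delta_E4 mulrBl mulrK ?unit_E4 // fabc100; congr (_ * (_ - _)).
  by rewrite -[in LHS]fabc010 -[in LHS]fabc001 fabcV fabc_mul.
have l6 : 12 * logd E6 = 6 * (fabc 1 0 0 - fabc 0 2 (-1)).
  have -> : 12 * logd E6 = 6 * (2 * delta E6 / E6) by rewrite /logd; ring.
  rewrite delta_E6 mulrBl mulrK ?unit_E6 // fabc100; congr (_ * (_ - _)).
  by rewrite -[in LHS]fabc010 -[in LHS]fabc001 fabcV expr2 !fabc_mul.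
rewrite -/(fabc 1 0 0) -/(fabc (-1) 1 0) -/(fabc 0 (-1) 1) -/(fabc 0 2 (-1)).
rewrite !rmorphD !rmorphM /=.
move: (logd E2) (logd E4) (logd E6) (fabc 1 0 0) (fabc (-1) 1 0)
  (fabc 0 (-1) 1) (fabc 0 2 (-1)) l2 l4 l6 => x y z p q r s l2 l4 l6.
transitivity (a%:~R * (12 * x) + b%:~R * (12 * y) + c%:~R * (12 * z)); first ring.
by rewrite l2 l4 l6; ring.
Qed.

Lemma delta_fabc (a b c : int) :
  12 * delta (fabc a b c) = (a + 4 * b + 6 * c)%:~R * fabc (a + 1) b c
    - a%:~R * fabc (a - 1) (b + 1) c - (4 * b)%:~R * fabc a (b - 1) (c + 1)
    - (6 * c)%:~R * fabc a (b + 2) (c - 1).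
Proof.
have -> : delta (fabc a b c) = logd (fabc a b c) * fabc a b c.
  by rewrite divrK // unit_fabc.
rewrite mulrA logd_fabc.
have := fabc_mul 1 0 0 a b c; have := fabc_mul (-1) 1 0 a b c.
have := fabc_mul 0 (-1) 1 a b c; have := fabc_mul 0 2 (-1) a b c.
rewrite !add0r ![_ + a]addrC ![_ + b]addrC ![_ + c]addrC.
move=> <- <- <- <-; rewrite !mulrBl; congr (_ - _ - _ - _); exact: esym (mulrA _ _ _).
Qed.

(** * Composition of power series *)

Section Composition.
Context (R : comNzRingType).
Implicit Types (f g t : fps R) (n : nat).

(** The cut at m = n is harmless when t has no constant term, because t^m then starts at q^m. *)
Definition fps_comp f t : fps R :=
  Fps (fun n => \sum_(m < n.+1) f m * (t ^+ m) n).

Lemma coef_fpsX_low t m n : t 0%N = 0 -> (n < m)%N -> (t ^+ m) n = 0.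
Proof.
move=> t0; elim: m n => // m IHm n ltnm.
rewrite exprS (@eq_coef_fpsM_low _ t _ 0) ?mulr0 // => i ltin.
by rewrite IHm //; lia.
Qed.

Lemma coef_fps_comp f t N n : t 0%N = 0 -> (n < N)%N ->
  fps_comp f t n = (\sum_(m < N) f m *: t ^+ m) n.
Proof.
move=> t0 ltnN; rewrite coef_fps_sum -[LHS](big_mkord xpredT (fun m => f m * (t ^+ m) n)).
rewrite -(big_mkord xpredT (fun m => (f m *: t ^+ m) n))
  [RHS](@big_nat_trunc _ _ 0 n.+1) //.
by move=> m ltm; rewrite coef_fpsZ coef_fpsX_low ?mulr0.
Qed.

Lemma fps_compD f g t : fps_comp (f + g) t = fps_comp f t + fps_comp g t.
Proof.
by apply/fpsP => n; rewrite /= -big_split; apply: eq_bigr => i _; rewrite mulrDl.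
Qed.

Lemma fps_compZ c f t : fps_comp (c *: f) t = c *: fps_comp f t.
Proof.
by apply/fpsP => n; rewrite /= mulr_sumr; apply: eq_bigr => i _; rewrite mulrA.
Qed.

Lemma fps_comp_coef0 f t : fps_comp f t 0%N = f 0%N.
Proof. by rewrite /= big_ord1 mulr1. Qed.

Definition fps_shift f : fps R := Fps (fun n => f n.+1).

Lemma fps_shiftE f : f = f 0%N *: (1 : fps R) + fps_q R * fps_shift f.
Proof.
apply/fpsP => -[|n]; rewrite coef_fpsD coef_fps_qM coef_fpsZ coef_fps1 ?mulr1 ?addr0 //.
by rewrite mulr0 add0r.
Qed.

Lemma fps_comp_shift f t : t 0%N = 0 ->
  fps_comp f t = f 0%N *: (1 : fps R) + t * fps_comp (fps_shift f) t.
Proof.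
move=> t0; apply/fpsP => n; rewrite coef_fpsD (coef_fps_comp f t0 (leqnn n.+1)).
rewrite coef_fps_sum big_ord_recl expr0; congr (_ + _).
have low i : (i < n)%N ->
    fps_comp (fps_shift f) t i = (\sum_(m < n) f m.+1 *: t ^+ m) i.
  by move=> ltin; rewrite (coef_fps_comp _ t0 ltin).
rewrite (eq_coef_fpsM_low t0 low) mulr_sumr coef_fps_sum; apply: eq_bigr => m _.
by rewrite exprS [t * (_ *: _)]mulrC -fps_scalerAl [_ * t]mulrC.
Qed.

Lemma fps_comp_qM f t : t 0%N = 0 -> fps_comp (fps_q R * f) t = t * fps_comp f t.
Proof.
move=> t0; rewrite (fps_comp_shift _ t0) coef_fps_qM scale0r add0r.
by congr (_ * fps_comp _ _); apply/fpsP => n; rewrite [LHS]coef_fps_qM.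
Qed.

Lemma fps_compM f g t : t 0%N = 0 ->
  fps_comp (f * g) t = fps_comp f t * fps_comp g t.
Proof.
move=> t0; apply/fpsP => n; elim/ltn_ind: n f => n IHn f.
rewrite {1}(fps_shiftE f) mulrDl -mulrA fps_compD fps_comp_qM //.
rewrite (fps_comp_shift f t0) [in RHS]mulrDl -[in RHS]mulrA !coef_fpsD; congr (_ + _).
  by rewrite -!fps_scalerAl !mul1r fps_compZ.
by apply: eq_coef_fpsM_low => // i ltin; rewrite IHn.
Qed.

(** The chain rule in logarithmic form: w replaces [delta t / t], as t is not a unit, and [delta f]
    is the Euler derivative of the outer series. *)
Lemma delta_fps_comp f t w : t 0%N = 0 -> delta t = w * t ->
  delta (fps_comp f t) = w * fps_comp (delta f) t.
Proof.
move=> t0 dt; have dtX m : delta (t ^+ m) = w * (t ^+ m *+ m).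
  case: m => [|m]; first by rewrite expr0 delta1 mulr0n mulr0.
  by rewrite deltaX dt mulrCA -exprSr mulrnAr.
apply/fpsP => n.
pose F (g : fps R) := \sum_(m < n.+1) g m *: t ^+ m.
have FE g i : (i <= n)%N -> fps_comp g t i = F g i.
  by move=> lein; rewrite (@coef_fps_comp g t n.+1).
rewrite (eq_coef_fpsM (fun i _ => erefl) (FE (delta f))) coef_delta FE //.
rewrite -coef_delta delta_sum mulr_sumr !coef_fps_sum; apply: eq_bigr => m _.
rewrite deltaZ dtX coef_delta [in RHS]mulrC -fps_scalerAl [in RHS]mulrC.
by rewrite mulrnAr -scalerMnr scalerMnl.
Qed.

End Composition.

(** * The hypergeometric series of 1/j *)

Definition hyp_coef m : nat := ('C(6 * m, 3 * m) * 'C(3 * m, m) * 'C(2 * m, m))%N.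

Lemma hyp_coef_fact m :
  (hyp_coef m * ((3 * m)`! * m`! ^ 3) = (6 * m)`!)%N.
Proof.
have f6 := @bin_fact (6 * m) (3 * m); have f3 := @bin_fact (3 * m) m.
have f2 := @bin_fact (2 * m) m.
rewrite -f6; last by lia.
have -> : (6 * m - 3 * m = 3 * m)%N by lia.
rewrite -{3}f3; last by lia.
have -> : (3 * m - m = 2 * m)%N by lia.
rewrite -[in (2 * m)`!]f2; last by lia.
have -> : (2 * m - m = m)%N by lia.
rewrite /hyp_coef; move: 'C(_, _) 'C(_, _) 'C(_, _) => x y z; ring.
Qed.

(** Among the six new factors of (6m + 6)!, the even ones are 8 (3m + 1)(3m + 2)(3m + 3) and cancel
    against (3m + 3)!; 6m + 3 = 3 (2m + 1) completes the constant 24. *)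
Lemma hyp_coefS m : (m.+1 ^ 3 * hyp_coef m.+1 =
  24 * ((6 * m + 1) * (2 * m + 1) * (6 * m + 5)) * hyp_coef m)%N.
Proof.
have := hyp_coef_fact m.+1; have := hyp_coef_fact m.
have -> : (6 * m.+1 = (6 * m).+1.+1.+1.+1.+1.+1)%N by lia.
have -> : (3 * m.+1 = (3 * m).+1.+1.+1)%N by lia.
rewrite !factS; have := fact_gt0 (3 * m); have := fact_gt0 m.
move: (hyp_coef m) (hyp_coef m.+1) ((3 * m)`!)%N (m`!)%N ((6 * m)`!)%N.
move=> u u' x y z y_gt0 x_gt0 <- uE.
have k_gt0 : (0 < (3 * m).+3 * (3 * m).+2 * (3 * m).+1 * (x * y ^ 3))%N.
  by rewrite !muln_gt0 x_gt0 y_gt0.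
apply/eqP; rewrite -(eqn_pmul2l k_gt0); apply/eqP.
transitivity (u' * ((3 * m).+3 * ((3 * m).+2 * ((3 * m).+1 * x)) * (m.+1 * y) ^ 3))%N.
  ring.
rewrite uE; ring.
Qed.

(** * Divisibility of u_i u_j by i + j + 1 *)

Lemma divn_double_gt z d : (0 < d <= 2 * z)%N -> (z %/ d < 2 * z %/ d)%N.
Proof.
move=> /andP[d_gt0 led2z]; rewrite leq_divRL // mulSn.
have [ltzd|ledz] := ltnP z d; first by rewrite divn_small // mul0n addn0.
by have := leq_trunc_div z d; lia.
Qed.

(* The p-adic valuation of hyp_coef m is the sum over k >= 1 of this quantity
   at d = p ^ k. *)
Definition hyp_excess m d : nat := 6 * m %/ d - (3 * m %/ d + 3 * (m %/ d)).

Lemma hyp_excessE m d :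
  (6 * m %/ d = hyp_excess m d + (3 * m %/ d + 3 * (m %/ d)))%N.
Proof.
rewrite subnK //; have [->|d_gt0] := posnP d; first by rewrite !divn0.
have le3 : (3 * (m %/ d) <= 3 * m %/ d)%N.
  by rewrite leq_divRL //; have := leq_trunc_div m d; nia.
apply: (@leq_trans (3 * m %/ d + 3 * m %/ d)%N); first by rewrite leq_add2l.
by rewrite leq_divRL //; have := leq_trunc_div (3 * m) d; nia.
Qed.

(** The residues x, y of i, j modulo d satisfy x + y + 1 >= d, so the larger one, say y, has 2y + 1
    >= d and hence 6y >= d. Then 3y / d and 6y / d have different floors, and their difference is
    the excess of j. *)
Lemma hyp_excess_gt0 i j d : (1 < d)%N -> (d %| i + j + 1)%N ->
  (0 < hyp_excess i d + hyp_excess j d)%N.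
Proof.
wlog leij : i j / (i %% d <= j %% d)%N => [wlog_le d_gt1 dij | d_gt1].
  have [leij|/ltnW leji] := leqP (i %% d) (j %% d); first exact: wlog_le.
  by rewrite addnC; apply: wlog_le; rewrite // [(j + i)%N]addnC.
have d_gt0 : (0 < d)%N by exact: ltnW.
rewrite {1}(divn_eq i d) {1}(divn_eq j d).
have -> : (i %/ d * d + i %% d + (j %/ d * d + j %% d) + 1 =
  (i %/ d + j %/ d) * d + (i %% d + j %% d + 1))%N by ring.
rewrite dvdn_addr ?dvdn_mull // => dvd_ij; rewrite addn_gt0; apply/orP; right.
have le_d : (d <= i %% d + j %% d + 1)%N by apply: dvdn_leq; rewrite // addn1.
move: (j %% d)%N (ltn_pmod j d_gt0) leij le_d (divn_eq j d) => y ltyd leij le_d jE.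
move: (j %/ d)%N jE => a jE.
have divj c : (c * j %/ d = c * a + c * y %/ d)%N.
  by rewrite jE mulnDr mulnA divnMDl.
have ex := hyp_excessE j d; move: ex; rewrite !divj -[j in (3 * (j %/ d))%N]mul1n divj.
rewrite !mul1n (divn_small ltyd).
have := @divn_double_gt (3 * y) d; rewrite mulnA; lia.
Qed.

Lemma logn_fact_wide p n N : prime p -> (n <= N)%N ->
  logn p n`! = (\sum_(1 <= k < N.+1) n %/ p ^ k)%N.
Proof.
move=> p_pr lenN; rewrite logn_fact // [RHS](@big_cat_nat _ _ _ n.+1) //=.
rewrite [X in _ = (_ + X)%N]big_nat [X in _ = (_ + X)%N]big1 ?addn0 // => k /andP[ltnk _].
by rewrite divn_small // (leq_trans ltnk) // ltnW // ltn_expl // prime_gt1.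
Qed.

Lemma hyp_coef_gt0 m : (0 < hyp_coef m)%N.
Proof. by rewrite !muln_gt0 !bin_gt0; lia. Qed.

Lemma logn_hyp_coef p m N : prime p -> (6 * m <= N)%N ->
  logn p (hyp_coef m) = (\sum_(1 <= k < N.+1) hyp_excess m (p ^ k))%N.
Proof.
move=> p_pr leN; have := congr1 (logn p) (hyp_coef_fact m).
move: (hyp_coef m) (hyp_coef_gt0 m) => u u_gt0.
rewrite !lognM ?muln_gt0 ?fact_gt0 //.
rewrite !(@logn_fact_wide p _ N) //; try lia.
under [X in _ = X -> _]eq_bigr => k _ do rewrite hyp_excessE.
by rewrite !big_split big1_eq /=; lia.
Qed.

(** For each prime p, every k >= 1 such that p^k divides i + j + 1 adds at least 1 to the valuation
    of the product, by [hyp_excess_gt0]. *)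
Lemma dvdn_hyp_coefM i j : (i + j + 1 %| hyp_coef i * hyp_coef j)%N.
Proof.
have uu_gt0 : (0 < hyp_coef i * hyp_coef j)%N by rewrite muln_gt0 !hyp_coef_gt0.
apply/dvdn_partP => [|p]; first by rewrite addn1.
rewrite mem_primes => /and3P[p_pr _ _]; rewrite p_part pfactor_dvdn //.
set N := (6 * (i + j + 1))%N.
rewrite (lognM _ (hyp_coef_gt0 i) (hyp_coef_gt0 j))
  !(@logn_hyp_coef p _ N) ?/N //; try lia.
rewrite -big_split /=; set e := logn p _.
have leeN : (e.+1 <= N.+1)%N.
  rewrite ltnS (@leq_trans (i + j + 1)) //; last by rewrite /N; lia.
  apply: ltnW; apply: leq_trans (ltn_expl e (prime_gt1 p_pr)) _.
  by apply: dvdn_leq; rewrite ?pfactor_dvdnn // addn1.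
rewrite (@big_cat_nat _ _ _ e.+1) //=.
apply: leq_trans (leq_addr _ _).
have sum1 : e = (\sum_(1 <= k < e.+1) 1)%N by rewrite sum_nat_const_nat subn1 muln1.
rewrite [X in (X <= _)%N]sum1 big_nat [X in (_ <= X)%N]big_nat.
apply: leq_sum => k /andP[k_gt0 lek].
apply: hyp_excess_gt0; last by rewrite pfactor_dvdn; [exact: lek | | rewrite addn1].
by rewrite (leq_trans _ (ltn_expl k (prime_gt1 p_pr))).
Qed.

Lemma fps_natI k (f g : fps int) : (0 < k)%N -> k%:R * f = k%:R * g -> f = g.
Proof.
move=> k_gt0 /fpsP kfg; apply/fpsP => n; have := kfg n; rewrite !coef_natM.
by apply: mulfI; rewrite pnatr_eq0 -lt0n.
Qed.

Definition hyp : fps int := Fps (fun m => (hyp_coef m)%:R).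

Lemma hyp_ode : delta (delta (delta hyp)) = fps_q int *
  (1728 * delta (delta (delta hyp)) + 2592 * delta (delta hyp)
   + 1104 * delta hyp + 120 * hyp).
Proof.
apply/fpsP => -[|m]; rewrite coef_fps_qM; first by rewrite !coef_delta mulr0n.
have dE (f : fps int) n : delta f n = n%:R * f n by rewrite mulr_natl.
rewrite !coef_fpsD !coef_natM !dE.
have -> : hyp m.+1 = (hyp_coef m.+1)%:R by [].
have -> : hyp m = (hyp_coef m)%:R by [].
transitivity ((m.+1 ^ 3 * hyp_coef m.+1)%N%:R : int); first ring.
rewrite hyp_coefS; ring.
Qed.

(** * The discriminant and the series 1/j *)

Definition disc12 : fps int := Fps (fun n =>
  \sum_(1 <= a < n.+1) ((5 * a ^ 3 + 7 * a ^ 5) %/ 12)%N%:R * lam a n).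

Lemma dvdn12 a : (12 %| 5 * a ^ 3 + 7 * a ^ 5)%N.
Proof.
rewrite /dvdn -modnDm -[(5 * _ %% _)%N]modnMmr -[(7 * _ %% _)%N]modnMmr.
rewrite -[(a ^ 3 %% _)%N]modnXm -[(a ^ 5 %% _)%N]modnXm modnMmr modnMmr modnDm.
by move: (a %% 12)%N (@ltn_pmod a 12 isT); do 12! [case=> //].
Qed.

Lemma disc12E : 12 * disc12 = 5 * lambert 3 + 7 * lambert 5.
Proof.
apply/fpsP => n; rewrite coef_fpsD !coef_natM !(coef_lambert _ (leqnn n)).
rewrite !mulr_sumr -big_split; apply: eq_bigr => a _ /=; rewrite !mulrA -mulrDl.
congr (_ * _); rewrite -natrM mulnC divnK ?dvdn12 //.
ring.
Qed.

(** The modular discriminant (E4^3 - E6^2) / 1728, expanded in Lambert series so that it is visibly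
    integral. Only the linear part (5 S3 + 7 S5) / 12, which is [disc12], needs a congruence. *)
Definition disc : fps int := disc12 + 100 * lambert 3 ^+ 2
  + 8000 * lambert 3 ^+ 3 - 147 * lambert 5 ^+ 2.

Lemma discE : 1728 * disc = E4 ^+ 3 - E6 ^+ 2.
Proof.
rewrite E4E E6E /disc; have := disc12E.
move: disc12 (lambert 3) (lambert 5) => d x y eqd.
by apply: (eq_of_multiple (c := 144) eqd); ring.
Qed.

Lemma fabc000 : fabc 0 0 0 = 1. Proof. by rewrite /fabc !expr0z !mulr1. Qed.

Lemma fabcX a b c k : fabc a b c ^+ k = fabc (a *+ k) (b *+ k) (c *+ k).
Proof.
by elim: k => [|k IHk]; rewrite ?fabc000 // exprS IHk fabc_mul -!mulrS.
Qed.

(* The q-expansion of 1/j. *)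
Definition jinv : fps int := disc * fabc 0 (-3) 0.

Lemma jinvE : 1728 * jinv = 1 - fabc 0 (-3) 2.
Proof.
rewrite /jinv mulrA discE -fabc010 -fabc001 !fabcX mulrBl !fabc_mul.
by congr (_ - _); rewrite -fabc000.
Qed.

Lemma jinv_coef0 : jinv 0%N = 0.
Proof.
have /fpsP/(_ 0%N) := jinvE; rewrite coef_natM coef_fpsD coef_fpsN fabc_coef0 subrr.
by move/eqP; rewrite mulf_eq0 pnatr_eq0 => /eqP.
Qed.

Lemma delta_jinv : delta jinv = fabc 0 (-1) 1 * jinv.
Proof.
apply: (@fps_natI 1728) => //; rewrite -delta_natM [RHS]mulrCA jinvE deltaD deltaN delta1.
apply: (@fps_natI 12) => //; rewrite mulrDr mulr0 mulrN delta_fabc.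
rewrite mulrBr fabc_mul mulr1.
have -> : fabc 0 (-3 + 2) (2 - 1) = fabc 0 (-1) 1 by [].
have -> : fabc (0 + 0) (-1 + -3) (1 + 2) = fabc 0 (-3 - 1) (2 + 1) by [].
move: (fabc _ _ _) (fabc _ _ _) (fabc _ _ _) (fabc _ _ _) => x y z t; ring.
Qed.

(* 12 times the derivation t d/dt with respect to t = 1/j. *)
Definition jder (f : fps int) : fps int := fabc 0 1 (-1) * (12 * delta f).

Lemma jderD f g : jder (f + g) = jder f + jder g.
Proof. by rewrite /jder deltaD !mulrDr. Qed.

Lemma jderN f : jder (- f) = - jder f.
Proof. by rewrite /jder deltaN !mulrN. Qed.

Lemma jderB f g : jder (f - g) = jder f - jder g.
Proof. by rewrite jderD jderN. Qed.

Lemma jder_natM k f : jder (k%:R * f) = k%:R * jder f.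
Proof. by rewrite /jder delta_natM; ring. Qed.

Lemma jderM f g : jder (f * g) = jder f * g + f * jder g.
Proof. by rewrite /jder deltaM; ring. Qed.

Lemma jder1 : jder 1 = 0.
Proof. by rewrite /jder delta1 !mulr0. Qed.

Lemma jder_coef0 f : jder f 0%N = 0.
Proof. by rewrite coef_fpsM0 coef_natM coef_delta mulr0n !mulr0. Qed.

(** E4 / E6 has constant term 1, so [jder] multiplies the leading coefficient by 12 times its index.
    This is nonzero for a positive index, whence uniqueness for equations whose other coefficients
    have no constant term. *)
Lemma jder_low (f : fps int) n m : (forall i, (i < n)%N -> f i = 0) -> (m <= n)%N ->
  jder f m = 12 * m%:R * f m.
Proof.
move=> f0 lemn; have dE k : (12 * delta f) k = 12 * k%:R * f k.
  by rewrite coef_natM coef_delta -mulrA; congr (_ * _); rewrite mulr_natl.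
rewrite coef_fpsM big_ord_recl fabc_coef0 mul1r subn0 dE big1 ?addr0 // => i _.
by rewrite dE f0 ?mulr0 //; have := ltn_ord i; rewrite /= /bump /=; lia.
Qed.

Lemma jder_uniq1 (x f : fps int) : x 0%N = 0 ->
  jder f = x * f -> f 0%N = 0 -> f = 0.
Proof.
move=> x0 df f0; apply/fpsP => n; elim/ltn_ind: n => -[//|n] IHn.
have := jder_low IHn (leqnn _); rewrite df.
rewrite (@eq_coef_fpsM_low _ x f 0) ?mulr0 // => /esym/eqP.
by rewrite !mulf_eq0 !pnatr_eq0 /= => /eqP.
Qed.

Lemma jder_uniq2 (x y f : fps int) : x 0%N = 0 -> y 0%N = 0 ->
  jder (jder f) = x * f + y * jder f -> f 0%N = 0 -> f = 0.
Proof.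
move=> x0 y0 df f0; apply/fpsP => n; elim/ltn_ind: n => -[//|n] IHn.
have low i : (i < n.+1)%N -> jder f i = 0.
  by move=> ltin; rewrite (jder_low IHn (ltnW ltin)) IHn ?mulr0.
have := jder_low low (leqnn _); rewrite df coef_fpsD (jder_low IHn (leqnn _)).
rewrite (@eq_coef_fpsM_low _ x f 0) ?mulr0 // (@eq_coef_fpsM_low _ y _ 0) ?mulr0 //.
by rewrite addr0 => /esym/eqP; rewrite !mulf_eq0 !pnatr_eq0 /= => /eqP.
Qed.

Lemma jder_fabc (a b c : int) :
  jder (fabc a b c) = (a + 4 * b + 6 * c)%:~R * fabc (a + 1) (b + 1) (c - 1)
    - a%:~R * fabc (a - 1) (b + 2) (c - 1) - (4 * b)%:~R * fabc a b c
    - (6 * c)%:~R * fabc a (b + 3) (c - 2).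
Proof.
rewrite /jder delta_fabc !mulrBr.
have mE (k : int) a' b' c' : fabc 0 1 (-1) * (k%:~R * fabc a' b' c') =
    k%:~R * fabc a' (b' + 1) (c' - 1).
  by rewrite mulrCA fabc_mul add0r [1 + _]addrC [-1 + _]addrC.
rewrite !mE subrK addrK; have -> : b + 1 + 1 = b + 2 by lia.
have -> : b + 2 + 1 = b + 3 by lia.
by have -> : c - 1 - 1 = c - 2 by lia.
Qed.

Lemma jder_fps_comp f : jder (fps_comp f jinv) = 12 * fps_comp (delta f) jinv.
Proof.
rewrite /jder (delta_fps_comp _ jinv_coef0 delta_jinv) mulrCA; congr (_ * _).
move: (fps_comp _ _) => x; rewrite mulrA fabc_mul.
by rewrite (_ : fabc _ _ _ = 1) ?mul1r // -fabc000.
Qed.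

(** * The identity E4 = A(1/j)^2 *)

Definition hyp_jinv : fps int := fps_comp hyp jinv.

Lemma hyp_jinv_coef0 : hyp_jinv 0%N = 1.
Proof. by rewrite fps_comp_coef0. Qed.

Lemma fps_comp_natM k (f t : fps int) : fps_comp (k%:R * f) t = k%:R * fps_comp f t.
Proof. by rewrite !fps_natmul fps_compZ. Qed.

(** This is [hyp_ode] at t = 1/j. The constants 2592 = 18 * 144 and 1104 = 92 * 12 shrink because
    [jder] carries a factor 12, and 1728 t is 1 - E6^2 / E4^3. *)
Lemma hyp_jinv_ode : jder (jder (jder hyp_jinv)) = (1 - fabc 0 (-3) 2) *
  (jder (jder (jder hyp_jinv)) + 18 * jder (jder hyp_jinv) + 92 * jder hyp_jinv
   + 120 * hyp_jinv).
Proof.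
have := congr1 (fun f => fps_comp f jinv) hyp_ode; rewrite fps_comp_qM ?jinv_coef0 //.
rewrite !fps_compD !fps_comp_natM /hyp_jinv -jinvE.
rewrite !(jder_fps_comp, jder_natM).
move: jinv (fps_comp _ _) (fps_comp _ _) (fps_comp _ _) (fps_comp _ _)
  => t c0 c1 c2 c3 e3.
by apply: (eq_of_multiple (c := 1728) e3); ring.
Qed.

Lemma solve_with_inverse (R : comPzRingType) (r s x y : R) :
  r * s = 1 -> x = (1 - s) * (x + y) -> x = (r - 1) * y.
Proof.
move=> rs eqx; have sx : s * x = (1 - s) * y.
  by apply: (eq_of_multiple (c := 1) eqx); ring.
rewrite -[LHS]mul1r -rs -mulrA sx mulrA; congr (_ * _).
by rewrite mulrBr mulr1 rs.
Qed.

(* The Riccati equation satisfied by the logarithmic derivative v of a solution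
   of the hypergeometric equation. *)
Definition riccati (v : fps int) : Prop :=
  jder (jder v) = (fabc 0 3 (-2) - 1) *
    (18 * (jder v + v ^+ 2) + 92 * v + 120) - 3 * v * jder v - v ^+ 3.

Lemma riccati_hyp_jinv : riccati (jder hyp_jinv / hyp_jinv).
Proof.
have Ua := unit_coef0 hyp_jinv_coef0; rewrite /riccati; set v := _ / _.
have d1 : jder hyp_jinv = v * hyp_jinv by rewrite divrK.
clearbody v; have d2 : jder (jder hyp_jinv) = (jder v + v ^+ 2) * hyp_jinv.
  by rewrite d1 (jderM v) d1; ring.
have := hyp_jinv_ode; rewrite d2 (jderM (jder v + v ^+ 2)) (jderD (jder v)).
rewrite [v ^+ 2]expr2 (jderM v) d1.
have eqs : fabc 0 3 (-2) * fabc 0 (-3) 2 = 1 by rewrite fabc_mul -fabc000.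
clear d1 d2.
move: (fabc 0 3 (-2)) (fabc 0 (-3) 2) eqs v (jder v) (jder (jder v)) => r s eqs v v1 v2.
move: hyp_jinv Ua => a Ua ode; apply: (mulIr Ua).
(* [X * a] is the third derivative of [a], and [Y * a] gathers the lower terms of the equation. *)
pose X := v2 + 3 * v * v1 + v ^+ 3; pose Y := 18 * (v1 + v ^+ 2) + 92 * v + 120.
have eqX : X * a = (1 - s) * (X * a + Y * a).
  by apply: etrans (etrans ode _); rewrite /X /Y; ring.
by apply: (eq_of_multiple (c := 1) (solve_with_inverse eqs eqX)); rewrite /X /Y; ring.
Qed.

(** This argument is half of [jder E4 / E4]. Polynomials in g = E2 E4 / E6 and r = E4^3 / E6^2 are
    stable under [jder], so the equation becomes a polynomial identity in g and r. *)
Lemma riccati_E2E4E6 : riccati (2 * (fabc 1 1 (-1) - 1)).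
Proof.
have dg : jder (fabc 1 1 (-1)) = - fabc 1 1 (-1) ^+ 2 - fabc 0 3 (-2)
    - 4 * fabc 1 1 (-1) + 6 * (fabc 1 1 (-1) * fabc 0 3 (-2)).
  rewrite jder_fabc fabcX fabc_mul.
  have -> : fabc (1 *+ 2) (1 *+ 2) (-1 *+ 2) = fabc (1 + 1) (1 + 1) (-1 - 1) by [].
  have -> : fabc (1 + 0) (1 + 3) (-1 + -2) = fabc 1 (1 + 3) (-1 - 2) by [].
  have -> : fabc (1 - 1) (1 + 2) (-1 - 1) = fabc 0 3 (-2) by [].
  move: (fabc _ _ _) (fabc _ _ _) (fabc _ _ _) (fabc _ _ _) => x y z t; ring.
have dr : jder (fabc 0 3 (-2)) = 12 * (fabc 0 3 (-2) ^+ 2 - fabc 0 3 (-2)).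
  rewrite jder_fabc fabcX.
  have -> : fabc (0 *+ 2) (3 *+ 2) (-2 *+ 2) = fabc 0 (3 + 3) (-2 - 2) by [].
  move: (fabc _ _ _) (fabc _ _ _) (fabc _ _ _) (fabc _ _ _) => x y z t; ring.
rewrite /riccati; move: (fabc 1 1 (-1)) (fabc 0 3 (-2)) dg dr => g r dg dr.
have -> : jder (2 * (g - 1)) = 2 * jder g by rewrite jder_natM jderB jder1 subr0.
rewrite jder_natM dg !(jderB, jderD, jderN, jder_natM, jderM, expr2) dg dr; ring.
Qed.

Lemma riccati_uniq (v w : fps int) : riccati v -> riccati w ->
  v 0%N = 0 -> w 0%N = 0 -> v = w.
Proof.
move=> ricv ricw v0 w0; apply: subr0_eq.
pose r := fabc 0 3 (-2) - 1.
have r0 : r 0%N = 0 by rewrite coef_fpsD coef_fpsN fabc_coef0 subrr.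
(* Coefficients of the linear equation for v - w, obtained by writing v v' - w w' = v (v - w)' + (v
   - w) w' and factoring v^3 - w^3. *)
apply: (@jder_uniq2 (r * (18 * (v + w) + 92) - (3 * jder w + (v ^+ 2 + v * w + w ^+ 2)))
  (18 * r - 3 * v)).
- have dw0 : (3 * jder w) 0%N = 0 by rewrite coef_natM jder_coef0 mulr0.
  have vw0 : (v ^+ 2 + v * w + w ^+ 2) 0%N = 0.
    by rewrite 2!coef_fpsD coef_fpsM0 !coef_fpsX0 v0 w0 mulr0 !expr0n !addr0.
  by rewrite coef_fpsD coef_fpsN coef_fpsM0 r0 mul0r [X in - X]coef_fpsD dw0 vw0.
- by rewrite coef_fpsD coef_fpsN coef_natM r0 coef_fpsM0 v0 !mulr0 subrr.
- by rewrite !jderB ricv ricw -/r; ring.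
- by rewrite coef_fpsD coef_fpsN v0 w0 subrr.
Qed.

Lemma E4_hyp_jinv : E4 = hyp_jinv ^+ 2.
Proof.
have Ua := unit_coef0 hyp_jinv_coef0.
pose V : fps int := 2 * (fabc 1 1 (-1) - 1).
have V0 : V 0%N = 0 by rewrite coef_natM coef_fpsD coef_fpsN fabc_coef0 subrr mulr0.
have vV : jder hyp_jinv / hyp_jinv = V.
  apply: riccati_uniq => //; first exact: riccati_hyp_jinv.
    exact: riccati_E2E4E6.
  by rewrite coef_fpsM0 jder_coef0 mul0r.
have da : jder hyp_jinv = V * hyp_jinv by rewrite -vV divrK.
have dE : jder E4 = 2 * V * E4.
  rewrite -fabc010 jder_fabc /V mulrA -mulrA mulrBl mul1r fabc_mul.
  have -> : fabc (1 + 0) (1 + 1) (-1 + 0) = fabc (0 + 1) (1 + 1) (0 - 1) by [].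
  move: (fabc _ _ _) (fabc _ _ _) (fabc _ _ _) (fabc _ _ _) => x y z t; ring.
apply: subr0_eq; apply: (@jder_uniq1 (2 * V)).
- by rewrite coef_natM V0 mulr0.
- by rewrite jderB dE expr2 jderM da; ring.
- by rewrite coef_fpsD coef_fpsN coef_fpsX0 hyp_jinv_coef0 expr1n E4_coef0 subrr.
Qed.

(** * The integral primitive of A^2 *)

Definition hyp_sqr_int : fps int := Fps (fun n => if n is m.+1 then
  \sum_(i < m.+1) ((hyp_coef i * hyp_coef (m - i)) %/ m.+1)%N%:R else 0).

Lemma delta_hyp_sqr_int : delta hyp_sqr_int = fps_q int * hyp ^+ 2.
Proof.
apply/fpsP => -[|m]; rewrite coef_fps_qM coef_delta ?mulr0n //.
rewrite expr2 coef_fpsM -sumrMnl; apply: eq_bigr => i _.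
rewrite -natrM -mulrnA divnK //; have := dvdn_hyp_coefM i (m - i).
by rewrite subnKC ?addn1 // -ltnS.
Qed.

Lemma E6_sub_exact :
  E6 - fabc 0 (-3) 3 = delta (1728 * fps_comp hyp_sqr_int jinv).
Proof.
rewrite delta_natM (delta_fps_comp _ jinv_coef0 delta_jinv) delta_hyp_sqr_int.
rewrite fps_comp_qM ?jinv_coef0 // expr2 fps_compM ?jinv_coef0 //.
rewrite -/hyp_jinv -expr2 -E4_hyp_jinv.
transitivity ((1728 * jinv) * (fabc 0 (-1) 1 * E4)); last ring.
rewrite jinvE -fabc010 fabc_mul mulrBl mul1r fabc_mul -fabc001.
by congr (_ - _); congr fabc.
Qed.

(** * Reduction modulo exact series *)

Section Exactness.

Let mp : fps int -> fps rat := fps_map intr.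

Lemma fps_mapD (f g : fps int) : mp (f + g) = mp f + mp g.
Proof. by apply/fpsP => n; rewrite coef_fpsD /= rmorphD. Qed.

Lemma fps_mapN (f : fps int) : mp (- f) = - mp f.
Proof. by apply/fpsP => n; rewrite coef_fpsN /= rmorphN. Qed.

Lemma coef_fpsMz (f : fps int) (k : int) n : (f *~ k) n = f n *~ k.
Proof.
by case: k => m; rewrite ?NegzE ?mulrNz ?coef_fpsN -!pmulrn coef_fpsMn.
Qed.

Lemma fps_map_intM (k : int) (f : fps int) : mp (k%:~R * f) = k%:~R *: mp f.
Proof.
apply/fpsP => n; rewrite coef_fpsZ -[LHS]/((k%:~R * f) n)%:~R -[mp f n]/(f n)%:~R.
by rewrite mulrzl coef_fpsMz mulrzz rmorphM mulrC.
Qed.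

Lemma fps_map_delta (f : fps int) : mp (delta f) = delta (mp f).
Proof. by apply/fpsP => n; rewrite coef_delta /= rmorphMn. Qed.

(* v agrees with a multiple of E6 up to delta of a series with bounded
   denominators. *)
Definition exact_mod_E6 (v : fps rat) : Prop :=
  exists2 N : int, 0 < N &
    exists w : fps int, N%:~R *: (v - v 0%N *: mp E6) = delta (mp w).

Lemma exact_mod_E6D u v :
  exact_mod_E6 u -> exact_mod_E6 v -> exact_mod_E6 (u + v).
Proof.
move=> [N N_gt0 [w uE]] [M M_gt0 [x vE]]; exists (N * M); first exact: mulr_gt0.
exists (M%:~R * w + N%:~R * x).
rewrite (fps_mapD (M%:~R * w)) !fps_map_intM deltaD !deltaZ -uE -vE !scalerA -!rmorphM.
rewrite [M * N]mulrC -scalerDr coef_fpsD scalerDl; congr (_ *: _).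
by rewrite addrACA -opprD.
Qed.

Lemma exact_mod_E6Z (c : rat) v : exact_mod_E6 v -> exact_mod_E6 (c *: v).
Proof.
move=> [N N_gt0 [w vE]]; exists (denq c * N); first by rewrite mulr_gt0 ?denq_gt0.
exists ((numq c)%:~R * w); rewrite fps_map_intM deltaZ -vE coef_fpsZ -scalerA -scalerBr.
rewrite !scalerA rmorphM /=; congr (_ *: _).
by rewrite -{2}(divq_num_den c); field; rewrite intr_eq0 denq_eq0.
Qed.

Lemma exact_mod_E6_delta w : exact_mod_E6 (delta (mp w)).
Proof.
by exists 1 => //; exists w; rewrite coef_delta mulr0n scale0r subr0 scale1r.
Qed.

Lemma exact_mod_E6_E6 : exact_mod_E6 (mp E6).
Proof.
exists 1 => //; exists 0.
have -> : mp E6 0%N = 1 by rewrite -[mp E6 0%N]/((E6 0%N)%:~R) E6_coef0.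
by rewrite !scale1r subrr; apply/fpsP => n; rewrite coef_delta /= mul0rn.
Qed.

Lemma exact_mod_E6_0 : exact_mod_E6 0.
Proof. by have := exact_mod_E6Z 0 exact_mod_E6_E6; rewrite scale0r. Qed.

Lemma exact_mod_E6_solve (c : rat) u v : c != 0 ->
  exact_mod_E6 (c *: u + v) -> exact_mod_E6 v -> exact_mod_E6 u.
Proof.
move=> c0 Pcuv Pv.
have := exact_mod_E6Z c^-1 (exact_mod_E6D Pcuv (exact_mod_E6Z (-1) Pv)).
by rewrite scaleN1r addrK scalerA mulVf // scale1r.
Qed.

(** The alternative c = 0 serves the edges of the range, where a relation names a monomial outside
    [U6] with coefficient 0. *)
Lemma exact_mod_E6_term (c : int) u : c = 0 \/ exact_mod_E6 u ->
  exact_mod_E6 (c%:~R *: u).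
Proof.
case=> [->|Pu]; first by rewrite scale0r; exact: exact_mod_E6_0.
exact: exact_mod_E6Z.
Qed.

(* The weight 6 monomials, indexed so that 2 k + 1 = a + c. *)
Definition mono6 (a k : int) : fps rat := mp (fabc a (a - 3 * k) (2 * k + 1 - a)).

(** This is 12 [delta] of the weight 4 monomial with exponents a, 1 + a - 3k, 2k - a. Two terms lie
    on level k and two on level k - 1. *)
Lemma exact_mono6_rel (a k : int) : exact_mod_E6
  ((4 - a)%:~R *: mono6 (a + 1) k + (- a)%:~R *: mono6 (a - 1) (k - 1)
   + (- 4 * (1 + a - 3 * k))%:~R *: mono6 a k
   + (- 6 * (2 * k - a))%:~R *: mono6 a (k - 1)).
Proof.
have := exact_mod_E6Z 12 (exact_mod_E6_delta (fabc a (1 + a - 3 * k) (2 * k - a))).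
have -> : 12 *: delta (mp (fabc a (1 + a - 3 * k) (2 * k - a))) =
    mp (12 * delta (fabc a (1 + a - 3 * k) (2 * k - a))).
  by rewrite (fps_map_intM 12) fps_map_delta.
rewrite delta_fabc !fps_mapD !fps_mapN !fps_map_intM /mono6 -!scaleNr -!rmorphN.
have -> : a + 4 * (1 + a - 3 * k) + 6 * (2 * k - a) = 4 - a by ring.
have -> : a + 1 - 3 * k = 1 + a - 3 * k by ring.
have -> : 2 * k + 1 - (a + 1) = 2 * k - a by ring.
have -> : a - 1 - 3 * (k - 1) = 1 + a - 3 * k + 1 by ring.
have -> : 2 * (k - 1) + 1 - (a - 1) = 2 * k - a by ring.
have -> : 1 + a - 3 * k - 1 = a - 3 * k by ring.
have -> : 2 * k - a + 1 = 2 * k + 1 - a by ring.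
have -> : 1 + a - 3 * k + 2 = a - 3 * (k - 1) by ring.
have -> : 2 * k - a - 1 = 2 * (k - 1) + 1 - a by ring.
by rewrite !mulNr.
Qed.

Lemma exact_mono6_up (a k : int) : a != 4 ->
    a = 0 \/ exact_mod_E6 (mono6 (a - 1) (k - 1)) ->
    1 + a - 3 * k = 0 \/ exact_mod_E6 (mono6 a k) ->
    2 * k - a = 0 \/ exact_mod_E6 (mono6 a (k - 1)) ->
  exact_mod_E6 (mono6 (a + 1) k).
Proof.
move=> a4 P1 P2 P3; apply: (@exact_mod_E6_solve (4 - a)%:~R); last first.
- apply: exact_mod_E6D (exact_mod_E6D (exact_mod_E6_term (c := - a) _)
    (exact_mod_E6_term (c := - 4 * (1 + a - 3 * k)) _))
    (exact_mod_E6_term (c := - 6 * (2 * k - a)) _).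
  + by case: P1 => [->|]; [left | right; eassumption].
  + by case: P2 => [->|]; [left; rewrite mulr0 | right; eassumption].
  + by case: P3 => [->|]; [left; rewrite mulr0 | right; eassumption].
- by rewrite !addrA; exact: exact_mono6_rel.
- by rewrite intr_eq0 subr_eq0 eq_sym.
Qed.

Lemma exact_mono6_down (a k : int) : 1 + a - 3 * k != 0 ->
    a = 4 \/ exact_mod_E6 (mono6 (a + 1) k) ->
    a = 0 \/ exact_mod_E6 (mono6 (a - 1) (k - 1)) ->
    2 * k - a = 0 \/ exact_mod_E6 (mono6 a (k - 1)) ->
  exact_mod_E6 (mono6 a k).
Proof.
move=> b0 P1 P2 P3; apply: (@exact_mod_E6_solve (- 4 * (1 + a - 3 * k))%:~R); last first.
- apply: exact_mod_E6D (exact_mod_E6D (exact_mod_E6_term (c := 4 - a) _)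
    (exact_mod_E6_term (c := - a) _)) (exact_mod_E6_term (c := - 6 * (2 * k - a)) _).
  + by case: P1 => [->|]; [left; rewrite subrr | right; eassumption].
  + by case: P2 => [->|]; [left | right; eassumption].
  + by case: P3 => [->|]; [left; rewrite mulr0 | right; eassumption].
- by rewrite addrA [X in X + _]addrC; exact: exact_mono6_rel.
- by rewrite intr_eq0 mulf_neq0.
Qed.

(** Levels 0 and 1 are climbed from a = 0, that is, from E6 and E6^3 / E4^3. From level 2 on, 1 + a
    - 3k is nonzero for a <= 4, so the relations can be solved downwards from a = 4, where the term
    in E2^5 is absent. *)
Lemma exact_mono6 (k a : nat) : (a <= 4)%N -> (a <= k.*2.+1)%N ->
  exact_mod_E6 (mono6 a k).
Proof.
have P00 : exact_mod_E6 (mono6 0 0).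
  have -> : mono6 0 0 = mp E6 by rewrite -fabc001.
  exact: exact_mod_E6_E6.
have P10 : exact_mod_E6 (mono6 1 0).
  by apply: (@exact_mono6_up 0 0) => //; [left | right | left].
have P01 : exact_mod_E6 (mono6 0 1).
  have -> : mono6 0 1 = mp (fabc 0 (-3) 3) by [].
  have -> : fabc 0 (-3) 3 = E6 - delta (1728 * fps_comp hyp_sqr_int jinv).
    by rewrite -E6_sub_exact subKr.
  rewrite (fps_mapD E6) fps_mapN fps_map_delta.
  apply: exact_mod_E6D exact_mod_E6_E6 _; rewrite -scaleN1r.
  exact/exact_mod_E6Z/exact_mod_E6_delta.
have P11 : exact_mod_E6 (mono6 1 1).
  by apply: (@exact_mono6_up 0 1) => //; [left | right | right].
have P21 : exact_mod_E6 (mono6 2 1).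
  by apply: (@exact_mono6_up 1 1) => //; right.
have P31 : exact_mod_E6 (mono6 3 1).
  by apply: (@exact_mono6_up 2 1) => //; [right | left | left].
case: k => [|k]; first by case: a => [|[|a]].
elim: k a => [|k IHk] a le4; first by case: a le4 => [|[|[|[|a]]]].
move=> _; have kE : (k.+2%:Z - 1 = k.+1%:Z) by lia.
have down m : (m <= 4)%N -> exact_mod_E6 (mono6 (4 - m)%N k.+2).
  elim: m => [|m IHm] lem.
    apply: exact_mono6_down; rewrite ?kE; [lia | by left | right | ].
      by apply: (IHk 3); lia.
    (* Below E2^4 on level 2 stands E2^4 E4 / E6, which is not in [U6]; its coefficient 2k - a
       vanishes. *)
    case: k IHk {kE} => [|k] IHk; first by left.
    by right; apply: IHk; lia.
  have mE : ((4 - m.+1)%N%:Z + 1 = (4 - m)%N%:Z) by lia.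
  apply: exact_mono6_down; rewrite ?kE ?mE; [lia | by right; apply: IHm; lia | | ].
    have [m3|m3] := eqVneq m 3; first by left; rewrite m3.
    right; have -> : (4 - m.+1)%N%:Z - 1 = (4 - m.+2)%N%:Z by lia.
    by apply: IHk; lia.
  by right; apply: IHk; lia.
by have := down (4 - a)%N (leq_subr _ _); rewrite subKn.
Qed.

Lemma exact_fabc (a b c : int) : 2 * a + 4 * b + 6 * c = 6 -> 0 <= a <= 4 ->
  0 <= c -> exact_mod_E6 (mp (fabc a b c)).
Proof.
move=> w6 /andP[a_ge0 le4] c_ge0.
(* Adding b = a - 3k and c = 2k + 1 - a gives k = 1 - b - c; it is nonnegative because 2k + 1 = a +
   c >= 0. *)
have := @exact_mono6 (absz (1 - b - c)%R) (absz a).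
have -> : mono6 (absz a) (absz (1 - b - c)%R) = mp (fabc a b c).
  by rewrite /mono6; congr (mp (fabc _ _ _)); lia.
by apply; lia.
Qed.

End Exactness.

Theorem theorem4 : forall v : fps rat, U6_0 v -> magnetic v.
Proof.
move=> v [[m [x [u [uS vE]]]] v0].
have [N N_gt0 [w vw]] : exact_mod_E6 v.
  rewrite vE; elim/big_rec: _ => [|i y _ Py]; first exact: exact_mod_E6_0.
  apply: exact_mod_E6D Py; apply: exact_mod_E6Z.
  by have [a [b [c [w6 a04 c_ge0 ->]]]] := uS i; exact: exact_fabc.
(* The constant term of [w] is invisible to [delta] and is reset to 0. *)
exists N => //; exists (Fps (fun n => if n is _.+1 then w n else 0)); split=> //.
apply/fpsP => -[|n]; first by rewrite coef_fpsZ /= invr0 !mulr0.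
(* The zero constant term of v removes the multiple of E6. *)
have /fpsP/(_ n.+1) := vw; rewrite v0 scale0r subr0 coef_delta !coef_fpsZ /= => wE.
by rewrite mulrA wE -[X in X / _]mulr_natr mulfK // pnatr_eq0.
Qed.
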